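(* Let $P^{00}$ and $Q^{00}$ be the laws on $\mathscr{U}$ of the bridges on $[0,1]$, from and to the origin, of two continuous-time random walks on $\mathbb{Z}$ with jump rates $j_+,j_-$ and $h_+,h_-$ respectively. Then $$d_{W,1}(P^{00},Q^{00})\le 9\,|j_+j_--h_+h_-|.$$
   Context: The continuous-time random walk on $\mathbb{Z}$ with (nonnegative) jump rates $j_+,j_-$ starts at $0$, jumps up by one at rate $j_+$ and down by one at rate $j_-$; $P^0$ is its law on $\mathbb{D}([0,1];\mathbb{Z})$ and its bridge is $P^{00}=P^0(\cdot\mid X_0=0,X_1=0)$. $\mathscr{U}$ is the set of pairs $U=(U^+,U^-)$ of finite disjoint subsets of $(0,1)$ with $|U^+|=|U^-|$. Piecewise constant càdlàg paths on $[0,1]$ from $0$ to $0$ with jumps $\pm1$ are in bijection with $\mathscr{U}$ by sending a path to ($U^+$ = set of times of $+1$ jumps, $U^-$ = set of times of $-1$ jumps). $\mathscr{U}$ carries the $\sigma$-algebra transported by this bijection, and bridge laws are identified with their push-forward to $\mathscr{U}$. Let $\mathscr{A}=(0,1)^2\setminus\{(u,u):u\in(0,1)\}$. For $(r,s)\in\mathscr{A}$ define $\Psi_{r,s}U=(U^+\cup\{r\},U^-\cup\{s\})$ if $r\notin U^+$, $s\notin U^-$; $\Psi_{r,s}U=(U^+\setminus\{r\},U^-\setminus\{s\})$ if $r\in U^+$, $s\in U^-$; and $\Psi_{r,s}U=U$ otherwise (also $\Psi_{r,s}U=U$ if the first rule would give a pair not in $\mathscr{U}$, i.e. if $r\in U^-$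 or $s\in U^+$; for each $U$ this concerns only a Lebesgue-null set of $(r,s)$). $d$ is the graph distance on $\mathscr{U}$ for which $U\ne V$ are neighbours iff $U=\Psi_{r,s}V$ for some $(r,s)\in\mathscr{A}$. $\mathrm{Lip}_1(\mathscr{U})$ is the set of measurable $f:\mathscr{U}\to\mathbb{R}$ with $|f(U)-f(V)|\le d(U,V)$, and $d_{W,1}(\mu,\nu)=\sup\{|\int f\,d\mu-\int f\,d\nu|:f\in\mathrm{Lip}_1(\mathscr{U}),\ f\ \mu\text{- and }\nu\text{-integrable}\}$. *)

(* Defs.v *)
From HB Require Import structures.
From mathcomp Require Import all_boot all_order all_algebra finmap.
From mathcomp Require Import all_classical all_reals all_analysis.

Set Implicit Arguments.
Unset Strict Implicit.
Unset Printing Implicit Defensive.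

Import Order.TTheory GRing.Theory Num.Theory.
Import numFieldNormedType.Exports.

Local Open Scope classical_set_scope.
Local Open Scope ring_scope.

(* Z is discrete, so a limit at [t] means being eventually constant near [t].
   A path on [0,1] is a total function on [R], normalized to 0 off [0,1]. *)
Definition cadlag01 (R : realType) (w : R -> int) : Prop :=
  [/\ forall t, 0 <= t < 1 -> \forall s \near t^'+, w s = w t,
      forall t, 0 < t <= 1 -> exists z, \forall s \near t^'-, w s = z
    & forall t, ~~ (0 <= t <= 1) -> w t = 0].

Record cadlagZ (R : realType) := CadlagZ {
  cadlagZ_fun :> R -> int;
  cadlagZP : `[< cadlag01 cadlagZ_fun >] }.

HB.instance Definition _ (R : realType) := [isSub for @cadlagZ_fun R].
HB.instance Definition _ (R : realType) := [Choice of cadlagZ R by <:].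

Lemma cadlag01_cst0 (R : realType) : `[< cadlag01 (fun _ : R => 0 : int) >].
Proof.
apply/asboolP; split=> // t _; first by near=> s.
by exists 0; near=> s.
Unshelve. all: by end_near. Qed.

HB.instance Definition _ (R : realType) :=
  isPointed.Build (cadlagZ R) (CadlagZ (cadlag01_cst0 R)).

Definition cylinders (R : realType) : set (set (cadlagZ R)) :=
  [set A | exists t : R, 0 <= t <= 1 /\
           exists z : int, A = [set w : cadlagZ R | w t = z]].

HB.instance Definition _ (R : realType) :=
  Measurable.copy (cadlagZ R) (g_sigma_algebraType (@cylinders R)).

(* [P0] is the law on D([0,1]; Z) of the walk started at 0 that jumps by +1 at
   rate [jp] and by -1 at rate [jm]: independent and stationary increments,
   whose law over a short time h is given up to o(h) by the jump rates. *)
Definition random_walk_law (R : realType) (jp jm : R)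
    (P0 : probability (cadlagZ R) R) : Prop :=
  [/\ P0 [set w : cadlagZ R | w 0 = 0] = 1%E,
      forall (n : nat) (t : nat -> R) (z : nat -> int),
        0 <= t 0%N -> t n <= 1 -> {homo t : i j / (i <= j)%N >-> i <= j} ->
        P0 [set w : cadlagZ R | forall i, (i < n)%N -> w (t i.+1) - w (t i) = z i] =
        (\prod_(i < n) P0 [set w : cadlagZ R | (w (t i.+1) - w (t i))%R = z i])%E,
      forall (s t : R) (z : int), 0 <= s -> s <= t -> t <= 1 ->
        P0 [set w : cadlagZ R | w t - w s = z] = P0 [set w : cadlagZ R | w (t - s) - w 0 = z]
    & [/\ h^-1 * fine (P0 [set w : cadlagZ R | w h - w 0 = 1]) @[h --> 0^'+] --> jp,
          h^-1 * fine (P0 [set w : cadlagZ R | w h - w 0 = -1]) @[h --> 0^'+] --> jm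
        & h^-1 * fine (P0 [set w : cadlagZ R | 1 < `|w h - w 0|]) @[h --> 0^'+] --> 0]].

Definition bridge_event (R : realType) : set (cadlagZ R) :=
  [set w : cadlagZ R | w 0 = 0 /\ w 1 = 0].

Definition bridge (R : realType) (P0 : probability (cadlagZ R) R)
    (A : set (cadlagZ R)) : \bar R :=
  (P0 (A `&` @bridge_event R) / P0 (@bridge_event R))%E.

Definition jump_pair (R : realType) (U : {fset R} * {fset R}) : bool :=
  [&& all (fun u => 0 < u < 1) U.1, all (fun u => 0 < u < 1) U.2,
      [disjoint U.1 & U.2]%fset & #|` U.1| == #|` U.2|].

Record jumpU (R : realType) := JumpU {
  jumpU_val : {fset R} * {fset R};
  jumpUP : jump_pair jumpU_val }.

HB.instance Definition _ (R : realType) := [isSub for @jumpU_val R].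
HB.instance Definition _ (R : realType) := [Choice of jumpU R by <:].

Definition ups (R : realType) (U : jumpU R) : {fset R} := (jumpU_val U).1.
Definition downs (R : realType) (U : jumpU R) : {fset R} := (jumpU_val U).2.

Lemma jump_pair0 (R : realType) : jump_pair (fset0 : {fset R}, fset0 : {fset R}).
Proof. by rewrite /jump_pair /= fdisjoint0X eqxx. Qed.

HB.instance Definition _ (R : realType) :=
  isPointed.Build (jumpU R) (JumpU (jump_pair0 R)).

Definition count_le (R : realType) (A : {fset R}) (t : R) : nat :=
  #|` [fset u in A | u <= t]%fset|.

Definition jump_path (R : realType) (U : jumpU R) (t : R) : int :=
  (count_le (ups U) t)%:Z - (count_le (downs U) t)%:Z.

Lemma near_count_le_right (R : realType) (A : {fset R}) (t : R) :
  \forall s \near t^'+, count_le A s = count_le A t.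
Proof.
have H : \forall s \near t^'+, forall u, u \in (A : seq R) -> (u <= s) = (u <= t).
  elim: (A : seq R) => [|a l IH]; first by near=> s.
  have [at_|ta] := leP a t.
    near=> s => u; rewrite inE => /orP[/eqP->|ul].
      by rewrite at_ (le_trans at_) // ltW.
    by move: u ul; near: s.
  near=> s => u; rewrite inE => /orP[/eqP->|ul].
    by rewrite !leNgt ta /=; apply/negbF; near: s; exact: nbhs_right_lt.
  by move: u ul; near: s.
near=> s; rewrite /count_le; congr (size (enum_fset _)).
apply/fsetP => u; rewrite !inE /=; case uA: (u \in A) => //=.
by apply: (near H s).
Unshelve. all: by end_near. Qed.

Lemma near_count_le_left (R : realType) (A : {fset R}) (t : R) :
  exists n, \forall s \near t^'-, count_le A s = n.
Proof.
exists #|` [fset u in A | u < t]%fset|.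
have H : \forall s \near t^'-, forall u, u \in (A : seq R) -> (u <= s) = (u < t).
  elim: (A : seq R) => [|a l IH]; first by near=> s.
  have [at_|ta] := ltP a t.
    near=> s => u; rewrite inE => /orP[/eqP->|ul].
      by rewrite at_; near: s; exact: nbhs_left_ge.
    by move: u ul; near: s.
  near=> s => u; rewrite inE => /orP[/eqP->|ul].
    rewrite [a < t]ltNge ta leNgt /=; apply/negbF; apply: lt_le_trans ta.
    by near: s; exact: nbhs_left_lt.
  by move: u ul; near: s.
near=> s; rewrite /count_le; congr (size (enum_fset _)).
apply/fsetP => u; rewrite !inE /=; case uA: (u \in A) => //=.
by apply: (near H s).
Unshelve. all: by end_near. Qed.

Lemma jump_path_cadlag (R : realType) (U : jumpU R) :
  `[< cadlag01 (jump_path U) >].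
Proof.
case: U => -[Up Um] U_ok; apply/asboolP; split=> t.
- move=> _; have Hp := near_count_le_right Up t.
  have Hm := near_count_le_right Um t.
  by near=> s; rewrite /jump_path /ups /downs /= (near Hp s) ?(near Hm s).
- move=> _; have [np Hp] := near_count_le_left Up t.
  have [nm Hm] := near_count_le_left Um t; exists (np%:Z - nm%:Z).
  by near=> s; rewrite /jump_path /ups /downs /= (near Hp s) ?(near Hm s).
- have /and4P[/allP /= p01 /allP /= m01 _ /eqP /= pm] := U_ok.
  rewrite negb_and -!ltNge => /orP[t0|t1]; rewrite /jump_path /ups /downs /=.
    have c0 A : (forall u, u \in A -> 0 < u < 1) -> count_le A t = 0%N.
      move=> A01; apply/eqP; rewrite cardfs_eq0; apply/eqP/fsetP => u.
      rewrite !inE /=; apply/negP => /andP[/A01 /andP[u0 _] ut].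
      by have := lt_trans (le_lt_trans ut t0) u0; rewrite ltxx.
    by rewrite !c0.
  have c1 A : (forall u, u \in A -> 0 < u < 1) -> count_le A t = #|` A|.
    move=> A01; congr (size (enum_fset _)); apply/fsetP => u.
    rewrite !inE /=; case uA: (u \in A) => //=.
    by have /andP[_ u1] := A01 u uA; rewrite ltW // (lt_trans u1).
  by rewrite !c1 // pm subrr.
Unshelve. all: by end_near. Qed.

(* The inverse of the bijection sending a path to its jump-time sets. *)
Definition path_of (R : realType) (U : jumpU R) : cadlagZ R :=
  CadlagZ (jump_path_cadlag U).

HB.instance Definition _ (R : realType) :=
  Measurable.copy (jumpU R) (g_sigma_algebra_preimageType (@path_of R)).

(* [P00] on the space of jump times is identified, through the bijection, with
   the bridge of [P0]. As the sigma-algebra is the transported one, the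
   equation determines [P00]. *)
Definition bridge_law (R : realType) (P0 : probability (cadlagZ R) R)
    (P00 : probability (jumpU R) R) : Prop :=
  forall A : set (cadlagZ R), measurable A ->
    pushforward P00 (@path_of R) A = bridge P0 A.

Definition Aset (R : realType) : set (R * R) :=
  [set rs | [/\ 0 < rs.1 < 1, 0 < rs.2 < 1 & rs.1 != rs.2]].

(* [insubd U V] is [V] when [V] satisfies [jump_pair], and [U] otherwise. *)
Definition Psi (R : realType) (r s : R) (U : jumpU R) : jumpU R :=
  if (r \notin ups U) && (s \notin downs U) then
    insubd U ((r |` ups U)%fset, (s |` downs U)%fset)
  else if (r \in ups U) && (s \in downs U) then
    insubd U ((ups U `\ r)%fset, (downs U `\ s)%fset)
  else U.

Definition neighbours (R : realType) (U V : jumpU R) : Prop :=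
  U <> V /\ exists rs, Aset rs /\ U = Psi rs.1 rs.2 V.

Fixpoint joined_in (R : realType) (n : nat) (U V : jumpU R) : Prop :=
  if n is m.+1 then exists W, neighbours U W /\ joined_in m W V else U = V.

(* With the usual convention that vertices joined by no walk are at distance
   [+oo]. *)
Definition graph_dist (R : realType) (U V : jumpU R) : \bar R :=
  ereal_inf [set n%:R%:E | n in [set n : nat | joined_in n U V]].

Definition Lip1 (R : realType) : set (jumpU R -> R) :=
  [set f : jumpU R -> R | measurable_fun setT f /\
           forall U V, ((`|f U - f V|)%R%:E <= graph_dist U V)%E].

Definition dW1 (R : realType) (mu nu : probability (jumpU R) R) : \bar R :=
  ereal_sup
    [set `| \int[mu]_U (f U)%:E - \int[nu]_U (f U)%:E |%E
    | f in [set f | [/\ @Lip1 R f, mu.-integrable setT (EFin \o f)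
                      & nu.-integrable setT (EFin \o f)]]].

(* Main.v *)
Require Import Defs.
From HB Require Import structures.
From mathcomp Require Import all_boot all_order all_algebra finmap.
From mathcomp Require Import all_classical all_reals all_analysis.
From mathcomp Require Import measurable_realfun.
From mathcomp Require Import ring lra zify.

Set Implicit Arguments.
Unset Strict Implicit.
Unset Printing Implicit Defensive.

Import Order.TTheory GRing.Theory Num.Theory.
Import numFieldNormedType.Exports.

Local Open Scope classical_set_scope.
Local Open Scope ring_scope.

(** Write la = jp * jm and let mu_n be the law of a configuration with n up-jumps
    and n down-jumps placed independently and uniformly in (0,1).  The bridge is
    the mixture
      P00 = Z(la)^-1 * \sum_n la ^ n / (n!)^2 * mu_n,
      Z(la) = \sum_n la ^ n / (n!)^2,
    so the rates only enter through la, and only through the number of pairs.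

    Distance between two mixtures.  A sample of mu_(n+1) is a sample of mu_n with
    one more pair inserted, hence at graph distance at most 1 from it; so for a
    1-Lipschitz f the means g n = \int f d mu_n satisfy |g (n+1) - g n| <= 1
    (pairs_mean_step).  It remains to compare the means of g under two weightings
    la ^ n / (n!)^2.  The difference of the two quotients is a double sum over
    pairs (a, b) whose terms carry the factor g a - g b, and
    |g a - g b| <= |a - b| <= |a^2 - b^2|; so it is at most the difference of the
    second moments.  Since n^2 / (n!)^2 = 1 / ((n-1)!)^2, the second moment of the
    weighting la is exactly la.  Hence the distance is at most |la - la'|
    (bessel_mean_lip), a fortiori at most 9 |la - la'|.

    Identification of the bridge.  Cut [0,1] into K = k * N cells.  Up to an event
    of probability K * P(|w_(1/K) - w_0| > 1) -> 0, the path moves by -1, 0 or 1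
    in each cell, and a path from 0 to 0 is described by a pair of disjoint sets of
    cells of the same size n, of probability p_+^n p_-^n p_0^(K - 2n).  The number of
    such pairs with prescribed positions at the times i / k, divided by K^(2n), satisfies
    up to O(1 / K) the recursion in n that governs the positions under mu_n; hence these
    quotients converge to the probabilities under mu_n divided by (n!)^2 (cvg_density).
    The unknown factor p_0^K cancels in the ratio that defines the bridge (grid_proba).
    Events that fix the path on a dyadic grid form a generating pi-system, so the two laws
    agree (bridge_law_mixture). *)

(** * The weights 1 / (n!)^2 and their means *)

Section weights.
Context {R : realType}.
Implicit Types (x y : R) (g : nat -> R).

Definition weight (n : nat) : R := ((n`!)%:R ^+ 2)^-1.

Lemma weight_ge0 n : 0 <= weight n.
Proof. by rewrite /weight invr_ge0 exprn_ge0. Qed.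

Lemma weight_gt0 n : 0 < weight n.
Proof. by rewrite /weight invr_gt0 exprn_gt0 // ltr0n fact_gt0. Qed.

Lemma weightS n : n.+1%:R ^+ 2 * weight n.+1 = weight n.
Proof. by rewrite /weight factS natrM exprMn invfM mulrA divff ?mul1r. Qed.

Lemma weight_le n : n.+1%:R * weight n <= 2 * (n`!)%:R^-1.
Proof.
have f0 : (0:R) < n`!%:R by rewrite ltr0n fact_gt0.
rewrite /weight expr2 invfM mulrA ler_pM2r ?invr_gt0//.
rewrite ler_pdivrMr// -natrM ler_nat.
elim: n {f0} => // n IH; rewrite factS.
have := fact_gt0 n; nia.
Qed.

(** One factor 1 / n! absorbs the linear growth of g, the other leaves the
    exponential series. *)
Lemma cvg_series_weight x g (C : R) : 0 <= x -> (forall n, `|g n| <= C * n.+1%:R) ->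
  cvgn (series (fun n => `|weight n * x ^+ n * g n|)).
Proof.
move=> x0 gC.
have C0 : 0 <= C.
  by have := gC 0%N; rewrite mulr1; apply: le_trans.
apply: (series_le_cvg (v_ := (fun n => 2 * C * exp_coeff x n))).
- by move=> n; exact: normr_ge0.
- by move=> n; rewrite mulr_ge0 ?mulr_ge0// /exp_coeff /= ?divr_ge0 ?exprn_ge0.
- move=> n; rewrite normrM (ger0_norm (mulr_ge0 (weight_ge0 n) (exprn_ge0 n x0))).
  apply: (@le_trans _ _ (weight n * x ^+ n * (C * n.+1%:R))).
    by apply: ler_wpM2l => //; rewrite mulr_ge0 ?weight_ge0 ?exprn_ge0.
  have -> : weight n * x ^+ n * (C * n.+1%:R) = (n.+1%:R * weight n) * (C * x ^+ n) by ring.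
  rewrite /exp_coeff /= (_ : 2 * C * _ = (2 * n`!%:R^-1) * (C * x ^+ n)); last first.
    by rewrite /=; ring.
  by apply: ler_wpM2r; rewrite ?weight_le// mulr_ge0 ?exprn_ge0.
- exact/is_cvg_seriesZ/is_cvg_series_exp_coeff.
Qed.

(** The value at 2 sqrt x of the modified Bessel function I_0; it normalizes the law
    of the number of pairs of jumps. *)
Definition bessel x : R := limn (series (fun n => weight n * x ^+ n)).
Definition bessel_with g x : R := limn (series (fun n => weight n * x ^+ n * g n)).

Lemma cvg_series_bessel x : 0 <= x -> cvgn (series (fun n => weight n * x ^+ n)).
Proof.
move=> x0; apply: normed_cvg.
have := @cvg_series_weight x (fun=> 1) 1 x0.
rewrite /normed_series_of /=.
under eq_fun do rewrite mulr1.
by apply => n; rewrite normr1 mul1r ler1n.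
Qed.

Lemma cvg_series_bessel_with g C x : 0 <= x -> (forall n, `|g n| <= C * n.+1%:R) ->
  cvgn (series (fun n => weight n * x ^+ n * g n)).
Proof. by move=> x0 gC; apply/normed_cvg/(cvg_series_weight x0 gC). Qed.

Lemma bessel_gt0 x : 0 <= x -> 0 < bessel x.
Proof.
move=> x0; apply: (@lt_le_trans _ _ (series (fun n => weight n * x ^+ n) 1%N)).
  by rewrite /series /= big_nat1 expr0 mulr1 weight_gt0.
apply: nondecreasing_cvgn_le; last exact: cvg_series_bessel.
apply/nondecreasing_seqP => n; rewrite /series /= big_nat_recr//= lerDl.
by rewrite mulr_ge0 ?weight_ge0 ?exprn_ge0.
Qed.

(** Multiplying by n^2 shifts the weights by one, so that the second moment of the
    number of pairs is x itself; on partial sums the shift loses one term. *)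
Lemma sum_second_moment x N :
  \sum_(0 <= n < N.+1) weight n * x ^+ n * n%:R ^+ 2 = x * \sum_(0 <= n < N) weight n * x ^+ n.
Proof.
rewrite big_nat_recl//= [n in _ * n ^+ 2](_ : _ = 0)// expr0n mulr0 add0r.
rewrite big_distrr /=; apply: eq_bigr => n _.
by rewrite -[in RHS]weightS exprS; ring.
Qed.

Let psum N (h : nat -> R) (z : R) : R := \sum_(0 <= n < N) weight n * z ^+ n * h n.

(** Symmetrizing the double sum in (a, b) makes the coefficient
    y ^ a x ^ b - y ^ b x ^ a of g a - g b appear, which has the sign of a - b.  The
    increment of g is therefore dominated termwise by that of n^2. *)
Lemma cross_sum_le x y g N : 0 <= x -> x <= y ->
  (forall n, `|g n.+1 - g n| <= 1) ->
  `|psum N g y * psum N (fun=> 1) x - psum N g x * psum N (fun=> 1) y| <=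
  psum N (fun n => n%:R ^+ 2) y * psum N (fun=> 1) x -
  psum N (fun n => n%:R ^+ 2) x * psum N (fun=> 1) y.
Proof.
move=> x0 xy g1; set S := psum N.
have y0 := le_trans x0 xy.
have gdist a b : `|g a - g b| <= `|a%:R ^+ 2 - b%:R ^+ 2|.
  wlog ab : a b / (b <= a)%N.
    by move=> H; case/orP: (leq_total a b) => ?; [rewrite distrC [leRHS]distrC|]; exact: H.
  have -> : `|a%:R ^+ 2 - b%:R ^+ 2 : R| = (a ^ 2 - b ^ 2)%N%:R.
    by rewrite natrB ?leq_exp2r// ger0_norm ?natrX// subr_ge0 -!natrX ler_nat leq_exp2r.
  apply: (@le_trans _ _ (a - b)%N%:R); last by rewrite ler_nat; nia.
  rewrite -(subnKC ab); move: (a - b)%N => d; rewrite addKn.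
  elim: d => [|d IH]; first by rewrite addn0 subrr normr0.
  rewrite addnS; apply: (le_trans (ler_distD (g (b + d)%N) _ _)).
  by rewrite -natr1 [leRHS]addrC lerD.
have sym h : S h y * S (fun=> 1) x - S h x * S (fun=> 1) y =
   2^-1 * \sum_(0 <= a < N) \sum_(0 <= b < N)
     weight a * weight b * (y ^+ a * x ^+ b - y ^+ b * x ^+ a) * (h a - h b).
  have E z t : S h z * S (fun=> 1) t = \sum_(0 <= a < N) \sum_(0 <= b < N)
     weight a * weight b * (z ^+ a * t ^+ b) * h a.
    rewrite /S /psum big_distrl /=; apply: eq_bigr => a _; rewrite big_distrr /=.
    by apply: eq_bigr => b _; ring.
  have E' z t : S h z * S (fun=> 1) t = \sum_(0 <= a < N) \sum_(0 <= b < N)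
     weight a * weight b * (z ^+ b * t ^+ a) * h b.
    by rewrite E exchange_big /=; apply: eq_bigr => a _; apply: eq_bigr => b _; ring.
  apply: (@mulfI _ 2); rewrite ?pnatr_eq0// mulrA divff ?pnatr_eq0// mul1r.
  have -> (u v : R) : 2 * (u - v) = (u - v) + (u - v) by ring.
  rewrite [in X in X + _]E [in X in _ - X + _]E [in X in _ + (X - _)]E' [in X in _ + (_ - X)]E'.
  rewrite -!sumrB -big_split /=; apply: eq_bigr => a _.
  by rewrite -!sumrB -big_split /=; apply: eq_bigr => b _; ring.
rewrite !sym normrM (@ger0_norm _ 2^-1) ?invr_ge0// ler_wpM2l ?invr_ge0//.
apply: (le_trans (ler_norm_sum _ _ _)); apply: ler_sum => a _.
apply: (le_trans (ler_norm_sum _ _ _)); apply: ler_sum => b _.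
rewrite -[leRHS]ger0_norm; last first.
  have wab : 0 <= weight a * weight b by rewrite mulr_ge0 ?weight_ge0.
  have key i j : (j <= i)%N -> 0 <= y ^+ i * x ^+ j - y ^+ j * x ^+ i.
    move=> ji; rewrite -(subnKC ji) !exprD.
    have -> : y ^+ j * y ^+ (i - j) * x ^+ j - y ^+ j * (x ^+ j * x ^+ (i - j)) =
      y ^+ j * x ^+ j * (y ^+ (i - j) - x ^+ (i - j)) by ring.
    by rewrite mulr_ge0 ?mulr_ge0 ?exprn_ge0// subr_ge0 lerXn2r// nnegrE.
  have key2 i j : (j <= i)%N -> (0 : R) <= i%:R ^+ 2 - j%:R ^+ 2.
    by move=> ji; rewrite subr_ge0 lerXn2r ?nnegrE// ler_nat.
  rewrite -mulrA mulr_ge0//; case/orP: (leq_total a b) => ab; last first.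
    by rewrite mulr_ge0 ?key ?key2.
  by rewrite -mulrNN !opprB mulr_ge0 ?key ?key2.
by rewrite !normrM; apply: ler_wpM2l => //; rewrite !mulr_ge0.
Qed.

(** The limit of cross_sum_le: by sum_second_moment the bounding difference tends to
    y - x times both normalizations. *)
Lemma bessel_mean_lip x y g C : 0 <= x -> 0 <= y ->
  (forall n, `|g n| <= C * n.+1%:R) -> (forall n, `|g n.+1 - g n| <= 1) ->
  `|bessel_with g x / bessel x - bessel_with g y / bessel y| <= `|x - y|.
Proof.
wlog xy : x y / x <= y.
  move=> H x0 y0 gC g1; case/orP: (le_total x y) => ?; first exact: H.
  by rewrite distrC [leRHS]distrC; exact: H.
move=> x0 y0 gC g1.
have Zx := bessel_gt0 x0; have Zy := bessel_gt0 y0.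
have -> : bessel_with g x / bessel x - bessel_with g y / bessel y =
  - ((bessel_with g y * bessel x - bessel_with g x * bessel y) / (bessel x * bessel y)).
  by field; rewrite !gt_eqF.
have Zxy : 0 < bessel x * bessel y by rewrite mulr_gt0.
rewrite normrN normrM (@gtr0_norm _ (_^-1)) ?invr_gt0//.
rewrite (@ler_pdivrMr _ (bessel x * bessel y))// [X in _ <= X * _]distrC.
rewrite (@ger0_norm _ (y - x)) ?subr_ge0//.
have cZ z : 0 <= z -> series (fun n => weight n * z ^+ n) @ \oo --> bessel z.
  exact: cvg_series_bessel.
have cG z : 0 <= z -> series (fun n => weight n * z ^+ n * g n) @ \oo --> bessel_with g z.
  by move=> z0; exact: cvg_series_bessel_with gC.
have cQ z : 0 <= z -> series (fun n => weight n * z ^+ n * n%:R ^+ 2) @ \oo --> z * bessel z.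
  move=> z0; rewrite -(cvg_shiftS); under eq_fun do rewrite /series /= sum_second_moment.
  by apply: cvgMr; exact: cZ.
have one z : series (fun n => weight n * z ^+ n) = series (fun n => weight n * z ^+ n * 1).
  by under [in RHS]eq_fun do rewrite mulr1.
have -> : (y - x) * (bessel x * bessel y) =
  (y * bessel y) * bessel x - (x * bessel x) * bessel y by ring.
rewrite distrC.
set L := (X in X <= _); set M := (X in _ <= X).
have cL : (fun N =>
    `|series (fun n => weight n * y ^+ n * g n) N * series (fun n => weight n * x ^+ n) N -
      series (fun n => weight n * x ^+ n * g n) N * series (fun n => weight n * y ^+ n) N|) @ \oo --> L.
  by rewrite /L distrC; apply: cvg_norm; apply: cvgB; apply: cvgM; auto.
have cM : (fun N =>
    series (fun n => weight n * y ^+ n * n%:R ^+ 2) N * series (fun n => weight n * x ^+ n) N -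
    series (fun n => weight n * x ^+ n * n%:R ^+ 2) N * series (fun n => weight n * y ^+ n) N) @ \oo --> M.
  by apply: cvgB; apply: cvgM; auto.
rewrite -(cvg_lim _ cL)// -(cvg_lim _ cM)//.
apply: ler_lim; [exact: cvgP cL|exact: cvgP cM|].
by apply: nearW => N; rewrite !one; exact: (cross_sum_le N).
Qed.
End weights.

(** * Exchanging a limit and a sum *)

(** Dominated convergence for series, with a number of summands m N that may depend on
    N.  The tails of f N and of l are controlled by the tail of b. *)
Lemma tannery (R : realType) (f : nat -> nat -> R) (l b : nat -> R) (m : nat -> nat) :
  (\forall N \near \oo, forall n, `|f N n| <= b n) -> cvgn (series b) ->
  (forall n, f N n @[N --> \oo] --> l n) ->
  (\forall N \near \oo, (N <= m N)%N) ->
  \sum_(0 <= n < m N) f N n @[N --> \oo] --> limn (series l).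
Proof.
move=> fb cb fl mN.
have lb n : `|l n| <= b n.
  have H : `|f N n| @[N --> \oo] --> `|l n| by apply: cvg_norm; exact: fl.
  rewrite -(cvg_lim _ H)//; apply: limr_le; first exact: cvgP H.
  by near=> N; near: N; apply: filterS fb => N; apply.
have b0 n : 0 <= b n by apply: le_trans (lb n).
have cl : cvgn (series l).
  by apply: normed_cvg; apply: (series_le_cvg _ _ lb).
apply/cvgrPdist_lt => e e0.
have e4 : 0 < e / 4 by rewrite divr_gt0.
have [M _ HM] : \forall M \near \oo, `|limn (series b) - series b M| < e / 4.
  by move/cvgrPdist_lt : cb; apply.
have tail_b p : (M <= p)%N -> \sum_(M <= n < p) b n < e / 4.
  move=> Mp.
  have -> : \sum_(M <= n < p) b n = series b p - series b M.
    by rewrite /series /= (big_cat_nat (leq0n M) Mp)//= addrAC subrr add0r.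
  have ndb : nondecreasing_seq (series b).
    by apply/nondecreasing_seqP => n; rewrite /series /= big_nat_recr//= lerDl.
  apply: le_lt_trans (HM M (leqnn M)); apply: le_trans (ler_norm _).
  by rewrite lerD2r; exact: nondecreasing_cvgn_le.
have hl : \forall p \near \oo, `|limn (series l) - series l p| < e / 4.
  by move/cvgrPdist_lt : cl; apply.
case: hl => P _ HP.
have main : \forall N \near \oo, `|\sum_(0 <= n < M) (f N n - l n)| < e / 4.
  have : \sum_(0 <= n < M) (f N n - l n) @[N --> \oo] --> (0 : R).
    rewrite [X in _ --> X](_ : 0 = \sum_(0 <= n < M) (l n - l n)); last first.
      by rewrite big1// => i _; rewrite subrr.
    by apply: cvg_big => [|i _]; [exact: add_continuous|apply: cvgB => //; exact: cvg_cst].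
  by move/cvgr0Pnorm_lt; exact.
near=> N.
have fbN : forall n, `|f N n| <= b n by near: N.
have MN : (M <= m N)%N.
  apply: (@leq_trans N); first by near: N; exact: nbhs_infty_ge.
  by near: N.
have PN : (P <= m N)%N.
  apply: (@leq_trans N); first by near: N; exact: nbhs_infty_ge.
  by near: N.
have -> : limn (series l) - \sum_(0 <= n < m N) f N n =
   (limn (series l) - series l (m N)) - \sum_(0 <= n < M) (f N n - l n)
    - \sum_(M <= n < m N) (f N n - l n).
  rewrite /series /= [in X in _ = X - _ - _](big_cat_nat (leq0n M) MN)//= !sumrB.
  by rewrite (big_cat_nat (leq0n M) MN)//=; ring.
have h1 := HP _ PN.
have h2 : `|\sum_(0 <= n < M) (f N n - l n)| < e / 4 by near: N.
have h3 : `|\sum_(M <= n < m N) (f N n - l n)| <= (e / 4) *+ 2.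
  apply: (le_trans (ler_norm_sum _ _ _)).
  apply: (@le_trans _ _ (\sum_(M <= n < m N) (b n *+ 2))).
    apply: ler_sum => n _; rewrite mulr2n; apply: (le_trans (ler_normB _ _)).
    exact: lerD.
  by rewrite sumrMnl lerMn2r/= ltW// tail_b.
apply: (le_lt_trans (ler_normB _ _)).
have := ler_normB (limn (series l) - series l (m N)) (\sum_(0 <= n < M) (f N n - l n)).
move: h1 h2 h3; rewrite mulr2n.
set u := `| _ |; set v := `| _ |; set w := `| _ |; set t := `| _ |.
lra.
Unshelve. all: by end_near. Qed.

(** * Counting configurations of jumps on a grid *)

(** The effect on the positions at the times 1/k, ..., k/k of an up-jump in the cell j
    of the grid of step 1/k. *)
Definition unit_step k (j : nat) : {ffun 'I_k -> int} :=
  [ffun i : 'I_k => ((j <= i)%N : nat)%:Z].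

Section configurations.
Variables k N : nat.
Local Notation cell := 'I_(k * N).
Local Notation conf := ({set cell} * {set cell})%type.
Implicit Types (AB : conf) (r s : cell) (x : {ffun 'I_k -> int}).

Definition cell_step r : {ffun 'I_k -> int} := unit_step k (r %/ N).

(** Positions at the k coarse times of a path whose up-jumps lie in the fine cells
    AB.1 and whose down-jumps lie in the fine cells AB.2. *)
Definition grid_position AB : {ffun 'I_k -> int} :=
  \sum_(a in AB.1) cell_step a - \sum_(b in AB.2) cell_step b.

Definition confs n x : {set conf} :=
  [set AB : conf | [&& [disjoint AB.1 & AB.2], #|AB.1| == n, #|AB.2| == n & grid_position AB == x]].

Definition fresh r s AB : bool :=
  [&& r != s, r \notin AB.1, r \notin AB.2, s \notin AB.1 & s \notin AB.2].

(** Removing the marked cells r and s is a bijection onto the smaller configurations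
    to which r and s can be added. *)
Lemma card_confs_pointed n x r s :
  #|[set AB : conf in confs n.+1 x | (r \in AB.1) && (s \in AB.2)]| =
  #|[set AB : conf in confs n (x - cell_step r + cell_step s)%R | fresh r s AB]|.
Proof.
pose f AB : conf := (r |: AB.1, s |: AB.2).
rewrite -[RHS](@card_in_imset _ _ f); last first.
  move=> [A1 B1] [A2 B2] /=; rewrite !inE /fresh /=.
  move=> /andP[_ /and5P[_ rA1 _ _ sB1]] /andP[_ /and5P[_ rA2 _ _ sB2]] [eA eB].
  rewrite -(finset.setU1K rA1) eA finset.setU1K//.
  by rewrite -(finset.setU1K sB1) eB finset.setU1K.
apply/eq_card => -[A B]; apply/idP/imsetP.
- rewrite !inE /= => /andP[/and4P[AB cA cB /eqP px] /andP[rA sB]].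
  have rB : r \notin B by rewrite (disjointFr AB rA).
  have sA : s \notin A by rewrite (disjointFl AB sB).
  have rs : r != s by apply: contraNneq rB => ->.
  exists (A :\ r, B :\ s); last by rewrite /f /= !finset.setD1K.
  have cA' : #|A :\ r| == n by move: cA; rewrite (cardsD1 r) rA add1n eqSS.
  have cB' : #|B :\ s| == n by move: cB; rewrite (cardsD1 s) sB add1n eqSS.
  rewrite !inE /fresh /= !inE !eqxx /= rs (negbTE rB) (negbTE sA) !andbF /= !andbT cA' cB' /=.
  apply/andP; split.
    by apply: disjointWl (finset.subD1set _ _) _; apply: disjointWr (finset.subD1set _ _) _.
  rewrite -px /grid_position /= (finset.big_setD1 r rA) (finset.big_setD1 s sB) /=.
  by apply/eqP/ffunP => i; rewrite !ffunE; ring.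
- move=> [[A' B']]; rewrite !inE /fresh /= => /andP[/and4P[AB cA cB /eqP px]].
  move=> /and5P[rs rA rB sA sB] [-> ->].
  rewrite !cardsU1 rA sB !add1n !eqSS cA cB !finset.setU11 /= andbT.
  apply/andP; split.
    rewrite -finset.setI_eq0 finset.setIUl finset.setU_eq0 !finset.setIUr !finset.setU_eq0.
    by rewrite !finset.setI_eq0 AB !disjoints1 disjoint_sym disjoints1 !inE rs rB sA.
  rewrite /grid_position /= (finset.big_setU1 _ rA) (finset.big_setU1 _ sB) /=; apply/eqP.
  have -> : \sum_(i in A') cell_step i = x - cell_step r + cell_step s + \sum_(b in B') cell_step b.
    by rewrite -px /grid_position /= subrK.
  by apply/ffunP => i; rewrite !ffunE; ring.
Qed.

(** Double counting of the configurations of size n.+1 with a marked up-cell and a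
    marked down-cell. *)
Lemma card_confs_rec n x : (n.+1 ^ 2 * #|confs n.+1 x| =
  \sum_(r : cell) \sum_(s : cell)
     #|[set AB : conf in confs n (x - cell_step r + cell_step s)%R | fresh r s AB]|)%N.
Proof.
under eq_bigr do under eq_bigr do rewrite -card_confs_pointed -sum1_card.
transitivity (\sum_(AB in confs n.+1 x) \sum_(r in AB.1) \sum_(s in AB.2) 1)%N.
  rewrite mulnC -sum_nat_const; apply: eq_bigr => -[A B].
  rewrite inE /= => /and4P[_ /eqP cA /eqP cB _].
  by rewrite !sum_nat_const cA cB muln1 expnS expn1.
rewrite (exchange_big_dep predT) //=; apply: eq_bigr => r _.
rewrite (exchange_big_dep predT) //=; apply: eq_bigr => s _.
by apply: eq_bigl => AB; rewrite !inE /= !andbA.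
Qed.

Lemma card_confs_rec_le n x : (n.+1 ^ 2 * #|confs n.+1 x| <=
  \sum_(r : cell) \sum_(s : cell) #|confs n (x - cell_step r + cell_step s)%R|)%N.
Proof.
rewrite card_confs_rec; apply: leq_sum => r _; apply: leq_sum => s _.
by apply: subset_leq_card; apply/fintype.subsetP => AB; rewrite inE => /andP[].
Qed.

Lemma card_confs_le n x : (n`! ^ 2 * #|confs n x| <= (k * N) ^ (2 * n))%N.
Proof.
elim: n x => [|n IH] x.
  rewrite mul1n expn0 -(finset.cards1 ((finset.set0, finset.set0) : conf)).
  apply: subset_leq_card; apply/fintype.subsetP => -[A B].
  by rewrite !inE /= !cards_eq0 => /and4P[_ /eqP -> /eqP -> _].
rewrite factS expnMn mulnC mulnA [(#|_| * _)%N]mulnC.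
apply: (@leq_trans (\sum_(r : cell) \sum_(s : cell) (k * N) ^ (2 * n))%N); last first.
  by rewrite !sum_nat_const !card_ord mulnS expnD mulnA.
apply: (leq_trans (leq_mul (card_confs_rec_le _ _) (leqnn _))).
rewrite big_distrl /=; apply: leq_sum => r _; rewrite big_distrl /=.
by apply: leq_sum => s _; rewrite mulnC.
Qed.

Let all_confs n : {set conf} :=
  [set AB : conf | [&& [disjoint AB.1 & AB.2], #|AB.1| == n & #|AB.2| == n]].

Lemma card_all_confs_le n : (#|all_confs n| <= (k * N) ^ (2 * n))%N.
Proof.
have bin_le m p : ('C(m, p) <= m ^ p)%N.
  apply: (@leq_trans (m ^_ p)).
    by rewrite -bin_ffact; apply: leq_pmulr; exact: fact_gt0.
  elim: p => // p IH; rewrite ffactnSr expnS mulnC; apply: leq_mul => //.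
  exact: leq_subr.
pose subsets := [set A : {set cell} | #|A| == n]%SET.
apply: (@leq_trans #|finset.setX subsets subsets|).
  apply: subset_leq_card; apply/fintype.subsetP => -[A B].
  by rewrite !inE /= => /and3P[_ -> ->].
by rewrite cardsX card_draws card_ord mul2n -addnn expnD leq_mul.
Qed.

(** Besides r = s, a bad pair (r, s) has one of its two cells among the 2n occupied
    ones: at most K + 4nK pairs among the K^2. *)
Lemma sum_not_fresh_le n AB : AB \in all_confs n ->
  (\sum_(r : cell) \sum_(s : cell) ~~ fresh r s AB <= (4 * n + 1) * (k * N))%N.
Proof.
rewrite inE => /and3P[_ /eqP cA /eqP cB].
have le r s : (~~ fresh r s AB <=
   (r == s) + ((r \in AB.1) + (r \in AB.2) + ((s \in AB.1) + (s \in AB.2))))%N.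
  rewrite /fresh; case: (r == s) => //=.
  by do 4 case: (_ \in _).
have cm (C : {set cell}) : (\sum_(r : cell) (r \in C) = #|C|)%N.
  by rewrite -sum1_card [RHS]big_mkcond; apply: eq_bigr => r _; case: ifP.
apply: (leq_trans (leq_sum _ (fun r _ => leq_sum _ (fun s _ => le r s)))).
rewrite (eq_bigr (fun r => 1 + ((k * N) * (r \in AB.1) + (k * N) * (r \in AB.2) + (n + n))))%N.
  rewrite !big_split /= !sum_nat_const !card_ord -!big_distrr /= !cm cA cB; nia.
move=> r _; rewrite !big_split /= !cm cA cB !sum_nat_const !card_ord.
congr (_ + _)%N; rewrite (bigD1 r) //= eqxx big1 ?addn0// => i.
by rewrite eq_sym => /negbTE ->.
Qed.

(** Ignoring that the added cells must be free overcounts by at most (4n + 1) K pairs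
    for each of the at most K^(2n) configurations, an error of order 1/K compared with
    K^(2n + 2). *)
Lemma card_confs_rec_ge n x :
  (\sum_(r : cell) \sum_(s : cell) #|confs n (x - cell_step r + cell_step s)%R| <=
   n.+1 ^ 2 * #|confs n.+1 x| + (k * N) ^ (2 * n) * ((4 * n + 1) * (k * N)))%N.
Proof.
rewrite card_confs_rec.
have step r s y : (#|confs n y| <= #|[set AB : conf in confs n y | fresh r s AB]| +
    \sum_(AB in all_confs n) ~~ fresh r s AB)%N.
  rewrite -sum1_card (bigID (fresh r s)) /= leq_add//.
    by rewrite -sum1_card; apply/eq_leq/eq_bigl => AB; rewrite !inE.
  rewrite [leqRHS]big_mkcond [leqLHS]big_mkcond /=; apply: leq_sum => AB _.
  rewrite !inE; case: ifP => // /andP[/and4P[-> -> -> _] ->] //.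
apply: (leq_trans (leq_sum _ (fun r _ => leq_sum _ (fun s _ => step r s _)))).
under eq_bigr do rewrite big_split /=.
rewrite big_split /= leq_add2l.
under eq_bigr do rewrite exchange_big /=.
rewrite exchange_big /=.
apply: (leq_trans (leq_sum _ (fun AB h => sum_not_fresh_le h))).
by rewrite sum_nat_const leq_mul2r card_all_confs_le orbT.
Qed.
End configurations.

Lemma sum_over_blocks (R : nzRingType) (k N : nat) (F : nat -> R) :
  \sum_(l < k * N) F (l %/ N)%N = N%:R * \sum_(i < k) F i.
Proof.
case: N => [|N].
  by rewrite muln0 big_ord0 mul0r.
rewrite -(big_mkord predT (fun l => F (l %/ N.+1)%N)) -(big_mkord predT F).
elim: k => [|k IH]; first by rewrite mul0n !big_geq// mulr0.
rewrite mulSn addnC (@big_cat_nat _ _ _ (k * N.+1)) ?leq_addr//= IH big_nat_recr//= mulrDr.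
congr (_ + _); rewrite -{1}[(k * N.+1)%N]add0n big_addn addKn big_nat.
rewrite (eq_bigr (fun=> F k)); last first.
  by move=> i /andP[_ iN]; rewrite divnDMl // divn_small.
by rewrite -big_nat sumr_const_nat subn0 mulr_natl.
Qed.

Lemma card_confs0 k N x : #|@confs k N 0 x| = (x == 0).
Proof.
have [->|x0] := eqVneq x 0.
  apply: etrans (finset.cards1 ((finset.set0, finset.set0) : {set 'I_(k * N)} * {set 'I_(k * N)})).
  apply/eq_card => -[A B]; rewrite !inE /= !cards_eq0 [RHS]xpair_eqE.
  case: eqP => [->|_]; case: eqP => [->|_]; rewrite ?andbF //=.
  by rewrite -finset.setI_eq0 finset.setI0 eqxx /grid_position /= !big_set0 subrr eqxx.
apply/eqP; rewrite cards_eq0; apply/eqP/setP => -[A B]; rewrite !inE /= !cards_eq0.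
apply/negbTE/negP => /and4P[_ /eqP -> /eqP ->]; rewrite /grid_position /= !big_set0 subrr eq_sym.
exact/negP.
Qed.

Section occupation.
Context {R : realType}.
Variable k : nat.
Implicit Types x : {ffun 'I_k -> int}.

(** The probability that the path with n pairs of independent uniform jumps takes the
    values x at the times 1/k, ..., k/k, computed by conditioning on the coarse cells
    i and j of the last pair. *)
Fixpoint pos_proba n x : R := if n is m.+1 then
    (k%:R ^+ 2)^-1 * \sum_(i < k) \sum_(j < k) pos_proba m (x - unit_step k i + unit_step k j)
  else (x == 0)%:R.

Definition density N n x : R := #|confs N n x|%:R / (k * N)%:R ^+ (2 * n).

Lemma density_ge0 N n x : 0 <= density N n x.
Proof. by rewrite divr_ge0 ?exprn_ge0. Qed.

Lemma density_le N n x : (0 < k * N)%N -> density N n x <= weight n.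
Proof.
move=> kN0; have K0 : (0 : R) < (k * N)%:R ^+ (2 * n) by rewrite exprn_gt0// ltr0n.
have f0 : (0 : R) < n`!%:R ^+ 2 by rewrite exprn_gt0// ltr0n fact_gt0.
rewrite /density /weight ler_pdivrMr// ler_pdivlMl// -!natrX -natrM ler_nat.
exact: card_confs_le.
Qed.

Let avg_density N n x : R :=
  (k%:R ^+ 2)^-1 * \sum_(i < k) \sum_(j < k) density N n (x - unit_step k i + unit_step k j).

Lemma avg_densityE N n x : (0 < k * N)%N -> avg_density N n x =
  (\sum_(r < k * N) \sum_(s < k * N)
     #|confs N n (x - cell_step r + cell_step s)%R|)%N%:R / (k * N)%:R ^+ (2 * n.+1).
Proof.
rewrite muln_gt0 => /andP[k0 N0].
have kR : k%:R != 0 :> R by rewrite pnatr_eq0 -lt0n.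
have NR : N%:R != 0 :> R by rewrite pnatr_eq0 -lt0n.
rewrite natr_sum; under eq_bigr do rewrite natr_sum.
rewrite (eq_bigr (fun r : 'I_(k * N) => N%:R * \sum_(j < k)
     #|confs N n (x - unit_step k (r %/ N) + unit_step k j)|%:R)); last first.
  move=> r _.
  exact: (@sum_over_blocks R k N
    (fun j => #|confs N n (x - unit_step k (r %/ N) + unit_step k j)|%:R)).
rewrite -big_distrr /= (sum_over_blocks k N (fun i => \sum_(j < k)
     #|confs N n (x - unit_step k i + unit_step k j)|%:R)).
rewrite /avg_density /density.
under eq_bigr do rewrite -big_distrl /=.
rewrite -big_distrl /= mulnS exprD natrM; field.
by rewrite expf_neq0 ?mulf_neq0// kR NR.
Qed.

Lemma density_rec N n x : (0 < k * N)%N ->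
  avg_density N n x - (4 * n + 1)%:R / (k * N)%:R <= n.+1%:R ^+ 2 * density N n.+1 x <= avg_density N n x.
Proof.
move=> kN0; have K0 : (0 : R) < (k * N)%:R by rewrite ltr0n.
have K2 : (0 : R) < (k * N)%:R ^+ (2 * n.+1) by rewrite exprn_gt0.
rewrite avg_densityE// /density mulrA ler_pM2r ?invr_gt0//; apply/andP; split.
  rewrite -(ler_pM2r K2) mulrBl !divfK ?gt_eqF// lerBlDr.
  have -> : (4 * n + 1)%:R / (k * N)%:R * (k * N)%:R ^+ (2 * n.+1) =
     ((k * N) ^ (2 * n) * ((4 * n + 1) * (k * N)))%N%:R :> R.
    rewrite mulnS exprD expr2 !natrM natrX natrD natrM natrM.
    by field; move: kN0; rewrite muln_gt0 !pnatr_eq0 !lt0n => /andP[-> ->].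
  by rewrite -natrX -natrM -natrD ler_nat card_confs_rec_ge.
by rewrite -natrX -natrM ler_nat card_confs_rec_le.
Qed.

(** By induction on n: density_rec is the recursion of pos_proba up to an error
    that vanishes as N grows, and the factor n.+1 ^ 2 turns into 1 / (n!)^2. *)
Lemma cvg_density n x : (0 < k)%N -> density N n x @[N --> \oo] --> weight n * pos_proba n x.
Proof.
move=> k0; elim: n x => [|n IH] x.
  rewrite (_ : (fun N => density N 0 x) = cst (weight 0 * pos_proba 0 x)); first exact: cvg_cst.
  apply/funext => N; rewrite /density /= /weight fact0 muln0 expr0 divr1 expr1n invr1 mul1r.
  by rewrite card_confs0.
have cavg : avg_density N n x @[N --> \oo] --> weight n * pos_proba n.+1 x.
  rewrite /avg_density /= mulrCA; apply: cvgMr; rewrite big_distrr /=.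
  apply: cvg_big => [|i _]; first exact: add_continuous.
  rewrite big_distrr /=.
  by apply: cvg_big => [|j _]; [exact: add_continuous|exact: IH].
have csmall : (4 * n + 1)%:R / (k * N)%:R @[N --> \oo] --> (0 : R).
  have H : (4 * n + 1)%:R / k%:R * @harmonic R N @[N --> \oo] --> (4 * n + 1)%:R / k%:R * (0 : R).
    by apply: cvgMr; exact: cvg_harmonic.
  rewrite mulr0 in H.
  rewrite -cvg_shiftS; apply: cvg_trans H; apply: near_eq_cvg; apply: nearW => N.
  by rewrite /harmonic /= natrM invfM mulrA.
have n1 : n.+1%:R ^+ 2 != 0 :> R by rewrite expf_neq0 ?pnatr_eq0.
have -> : weight n.+1 * pos_proba n.+1 x = (n.+1%:R ^+ 2)^-1 * (weight n * pos_proba n.+1 x).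
  by rewrite -(weightS n) -[X in _ = _ * X]mulrA mulKf.
under eq_fun do rewrite -[density _ _ _](mulKf n1).
apply: cvgMr.
apply: (squeeze_cvgr (f := fun N => avg_density N n x - (4 * n + 1)%:R / (k * N)%:R) _ _ cavg).
  near=> N; apply: density_rec; rewrite muln_gt0 k0; near: N.
  exact: nbhs_infty_gt.
by have := cvgB cavg csmall; rewrite subr0; apply.
Unshelve. all: by end_near. Qed.
End occupation.

(** * Grid events of a random walk *)

Lemma probaI_full d (T : measurableType d) (R : realType) (P : probability T R)
    (A S : set T) :
  measurable A -> measurable S -> P (~` S) = 0%E -> P (A `&` S) = P A.
Proof.
move=> mA mS PS; rewrite [RHS](measureDI P mA mS) [X in (X + _)%E](_ : _ = 0%E) ?add0e//.
by apply: (subset_measure0 _ _ _ PS) => //; [exact: measurableD|exact: measurableC].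
Qed.

Lemma measure_bigcup_finType d (T : measurableType d) (R : realType)
    (mu : {measure set T -> \bar R}) (I : finType) (S : {pred I}) (F : I -> set T) :
  (forall i, measurable (F i)) -> trivIset [set i | i \in S] F ->
  mu (\bigcup_(i in [set i | i \in S]) F i) = (\sum_(i in S) mu (F i))%E.
Proof.
move=> mF tF; have e : [set i | i \in S] = [set` enum S].
  by apply/seteqP; split => i /=; rewrite mem_enum.
rewrite measure_fin_bigcup//.
by rewrite e -fsbig_seq ?enum_uniq// big_enum.
Qed.

(** Paths take countably many values at finitely many times: the event is a countable
    union of finite intersections of cylinders, whatever Q is. *)
Lemma measurable_times (R : realType) m (t : 'I_m -> R) (Q : set {ffun 'I_m -> int}) :
  (forall i, 0 <= t i <= 1) ->
  measurable [set w : cadlagZ R | Q [ffun i => w (t i)]].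
Proof.
move=> t01.
rewrite (_ : [set w | _] = \bigcup_(y : {ffun 'I_m -> int}) ([set w : cadlagZ R | Q y] `&`
   \bigcap_(i in [set: 'I_m]) [set w : cadlagZ R | w (t i) = y i])); last first.
  apply/seteqP; split=> w /=.
    by move=> Qw; exists [ffun i => w (t i)] => //; split => // i _ /=; rewrite ffunE.
  move=> [y _ [Qy /= wy]]; rewrite (_ : [ffun i => _] = y)//.
  by apply/ffunP => i; rewrite ffunE wy.
apply: countable_bigcupT_measurable; first exact: countableP.
move=> y; apply: measurableI.
  have [Qy|nQy] := pselect (Q y).
    by rewrite (_ : [set w | _] = setT)//; apply/seteqP; split.
  by rewrite (_ : [set w | _] = set0)//; apply/seteqP; split.
apply: fin_bigcap_measurable; first exact: finite_finset.
move=> i _; apply: sub_sigma_algebra; exists (t i); split; first exact: t01.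
by exists (y i).
Qed.

Section words.
Variables k N : nat.
Local Notation cell := 'I_(k * N).
Local Notation conf := ({set cell} * {set cell})%type.
Implicit Types (AB : conf).

(** The increment over the cell l of the path described by AB.  The index is a natural
    number, as in the independence property of the walk, and is 0 off the grid. *)
Definition incr_word AB (l : nat) : int :=
  if insub l is Some a then ((a : cell) \in AB.1)%:Z - (a \in AB.2)%:Z else 0.

Lemma incr_word_cell AB (a : cell) : incr_word AB a = (a \in AB.1)%:Z - (a \in AB.2)%:Z.
Proof. by rewrite /incr_word valK. Qed.

Lemma grid_positionE AB (i : 'I_k) : (0 < N)%N ->
  grid_position AB i = \sum_(0 <= l < i.+1 * N) incr_word AB l.
Proof.
move=> N0.
rewrite (big_nat_widen _ _ (k * N)) ?leq_mul2r ?ltn_ord ?orbT//.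
rewrite big_mkord big_mkcond /=.
have E (C : {set cell}) : (\sum_(a in C) cell_step a) i =
    \sum_(a : cell) if (a < i.+1 * N)%N then (a \in C)%:Z else 0.
  rewrite sum_ffunE big_mkcond /=; apply: eq_bigr => a _.
  rewrite !ffunE -ltnS ltn_divLR//.
  by case: (a \in C); case: (_ < _)%N.
rewrite /grid_position !ffunE !E -sumrB; apply: eq_bigr => a _.
by rewrite incr_word_cell; case: ifP => //; rewrite subrr.
Qed.

Lemma prod_incr_word (R : comNzRingType) (p : int -> R) AB : [disjoint AB.1 & AB.2]%B ->
  \prod_(i < k * N) p (incr_word AB i) =
  p 1 ^+ #|AB.1| * p (-1) ^+ #|AB.2| * p 0 ^+ (k * N - #|AB.1| - #|AB.2|).
Proof.
move=> dAB.
rewrite (bigID (mem AB.1)) /= -mulrA; congr (_ * _).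
  rewrite -prodr_const; apply: eq_bigr => a aA.
  by rewrite incr_word_cell aA (disjointFr dAB aA).
rewrite (bigID (mem AB.2)) /=; congr (_ * _).
  rewrite -prodr_const; apply: eq_big => [a|a /andP[/negbTE aA aB]].
    case aB: (a \in AB.2); rewrite ?andbF// andbT.
    by rewrite (disjointFl dAB aB).
  by rewrite incr_word_cell aA aB.
rewrite -subnDA.
have <- : #|~: (AB.1 :|: AB.2)| = (k * N - (#|AB.1| + #|AB.2|))%N.
  rewrite cardsCs finset.setCK card_ord; congr (_ - _)%N.
  by rewrite cardsU; move: dAB; rewrite -finset.setI_eq0 => /eqP ->; rewrite cards0 subn0.
rewrite -prodr_const; apply: eq_big => [a|a /andP[/negbTE aA /negbTE aB]].
  by rewrite !inE negb_or.
by rewrite incr_word_cell aA aB.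
Qed.

End words.

Section grid.
Context {R : realType}.
Variables (jp jm : R) (P0 : probability (cadlagZ R) R).
Hypothesis walk : random_walk_law jp jm P0.

Definition incr_proba (h : R) (z : int) : R := fine (P0 [set w : cadlagZ R | w h - w 0 = z]).

Definition start_at0 : set (cadlagZ R) := [set w : cadlagZ R | w 0 = 0].

Definition grid_event k (x : {ffun 'I_k -> int}) : set (cadlagZ R) :=
  [set w : cadlagZ R | forall i : 'I_k, w (i.+1%:R / k%:R) = x i].

Lemma measurable_grid_event k x : measurable (@grid_event k x).
Proof.
rewrite (_ : grid_event x =
  [set w : cadlagZ R | [set y | y = x] [ffun i : 'I_k => w (i.+1%:R / k%:R)]]).
  apply: measurable_times => i; rewrite divr_ge0//= ler_pdivrMr ?mul1r ?ler_nat//.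
  by rewrite ltr0n; case: k i x => // - [].
apply/seteqP; split => w /= wx; first by apply/ffunP => i; rewrite ffunE wx.
by move=> i; rewrite -wx ffunE.
Qed.

Lemma measurable_incr (s t : R) (Q : set int) : 0 <= s <= 1 -> 0 <= t <= 1 ->
  measurable [set w : cadlagZ R | Q (w t - w s)].
Proof.
move=> s01 t01.
pose u (i : 'I_2) : R := if i == ord0 then s else t.
rewrite (_ : [set w | _] = [set w : cadlagZ R |
   [set y : {ffun 'I_2 -> int} | Q (y ord_max - y ord0)] [ffun i : 'I_2 => w (u i)]]).
  by apply: measurable_times => i; rewrite /u; case: ifP.
by apply/seteqP; split => w /=; rewrite !ffunE.
Qed.

Lemma measurable_start_at0 : measurable start_at0.
Proof.
rewrite (_ : start_at0 = [set w : cadlagZ R |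
   [set y : {ffun 'I_1 -> int} | y ord0 = 0] [ffun i : 'I_1 => w 0]]).
  by apply: measurable_times => i; rewrite lexx ler01.
by apply/seteqP; split => w /=; rewrite !ffunE.
Qed.

Lemma proba_start_at0I A : measurable A -> P0 (A `&` start_at0) = P0 A.
Proof.
move=> mA; case: walk => P1 _ _ _; have m0 := measurable_start_at0.
by apply: probaI_full => //; rewrite probability_setC// P1 subee.
Qed.

Variables k N : nat.
Local Notation K := (k * N)%N.
Hypothesis K_gt0 : (0 < K)%N.
Local Notation conf := ({set 'I_K} * {set 'I_K})%type.
Let tau (l : nat) : R := l%:R / K%:R.
Local Notation p := (incr_proba K%:R^-1).

Lemma tau01 l : (l <= K)%N -> 0 <= tau l <= 1.
Proof.
by move=> lK; rewrite divr_ge0//= ler_pdivrMr ?ltr0n// mul1r ler_nat.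
Qed.

Lemma proba_incr z l : (l < K)%N ->
  P0 [set w : cadlagZ R | w (tau l.+1) - w (tau l) = z] = (p z)%:E.
Proof.
move=> lK; case: walk => _ _ stat _.
have /andP[l0 _] := tau01 (ltnW lK); have /andP[_ l1] := tau01 lK.
rewrite stat//; last by rewrite ler_pM2r ?invr_gt0 ?ltr0n// ler_nat.
have -> : tau l.+1 - tau l = K%:R^-1.
  by rewrite /tau -mulrBl -natrB// subSnn mul1r.
rewrite /incr_proba fineK// fin_num_measure//.
apply: (measurable_incr [set z]); first by rewrite lexx ler01.
by rewrite invr_ge0 ler0n/= invf_le1 ?ltr0n// ler1n.
Qed.

Definition word_event (AB : conf) : set (cadlagZ R) :=
  [set w : cadlagZ R | forall l, (l < K)%N -> w (tau l.+1) - w (tau l) = incr_word AB l].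

Lemma measurable_word_event AB : measurable (word_event AB).
Proof.
rewrite (_ : word_event AB = \bigcap_(l in `I_K)
   [set w : cadlagZ R | [set incr_word AB l] (w (tau l.+1) - w (tau l))]).
  apply: fin_bigcap_measurable; first exact: finite_II.
  move=> l /= lK; apply: (measurable_incr [set incr_word AB l]); apply: tau01 => //; exact: ltnW.
by apply/seteqP; split => w /= h l; exact: h.
Qed.

Lemma proba_word_event (AB : conf) : [disjoint AB.1 & AB.2]%B ->
  P0 (word_event AB) = (p 1 ^+ #|AB.1| * p (-1) ^+ #|AB.2| * p 0 ^+ (K - #|AB.1| - #|AB.2|))%:E.
Proof.
move=> dAB; case: walk => _ indep _ _.
rewrite indep.
- rewrite -prod_incr_word// -prodEFin; apply: eq_bigr => l _; exact: proba_incr.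
- by have /andP[] := tau01 (leq0n K).
- by have /andP[] := tau01 (leqnn K).
- by move=> i j ij; rewrite ler_pM2r ?invr_gt0 ?ltr0n// ler_nat.
Qed.

Definition unit_incr_event : set (cadlagZ R) :=
  [set w : cadlagZ R | forall l, (l < K)%N -> `|w (tau l.+1) - w (tau l)| <= 1].

Lemma measurable_unit_incr_event : measurable unit_incr_event.
Proof.
rewrite (_ : unit_incr_event = \bigcap_(l in `I_K)
   [set w : cadlagZ R | [set z : int | `|z| <= 1] (w (tau l.+1) - w (tau l))]).
  apply: fin_bigcap_measurable; first exact: finite_II.
  move=> l /= lK; apply: (measurable_incr [set z : int | `|z| <= 1]); apply: tau01 => //.
  exact: ltnW.
by apply/seteqP; split => w /= h l; exact: h.
Qed.

Let confs_at (x : {ffun 'I_k -> int}) : {set conf} :=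
  [set AB : conf | [disjoint AB.1 & AB.2]%B && (grid_position AB == x)]%SET.

(** When no increment over a fine cell exceeds 1 in absolute value, the path on the fine
    grid is encoded by the sets of cells where it goes up and down. *)
Lemma grid_event_words (x : {ffun 'I_k -> int}) :
  grid_event x `&` start_at0 `&` unit_incr_event =
  \bigcup_(AB in [set AB : conf | AB \in confs_at x]) (word_event AB `&` start_at0).
Proof.
have [k0 N0] : (0 < k /\ 0 < N)%N by move: K_gt0; rewrite muln_gt0 => /andP.
have posw AB (w : cadlagZ R) : word_event AB w -> start_at0 w ->
    forall i : 'I_k, w (i.+1%:R / k%:R) = grid_position AB i.
  move=> ww w0 i; rewrite grid_positionE//.
  rewrite (eq_big_nat _ _ (F2 := fun l => w (tau l.+1) - w (tau l))); last first.
    move=> l /andP[_ li]; rewrite ww//; apply: (leq_trans li).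
    by rewrite leq_mul2r ltn_ord orbT.
  rewrite telescope_sumr// /tau mul0r w0 subr0; congr (w _).
  by rewrite !natrM -mulf_div divff ?mulr1// pnatr_eq0 -lt0n.
apply/seteqP; split => w.
- move=> [[xw w0] sw].
  pose AB : conf := ([set a : 'I_K | w (tau a.+1) - w (tau a) == 1]%SET,
                     [set a : 'I_K | w (tau a.+1) - w (tau a) == -1]%SET).
  have ww : word_event AB w.
    move=> l lK; rewrite -[l]/(val (Ordinal lK)) incr_word_cell !inE /=.
    have := sw l lK; set d := w _ - w _.
    by move=> d1; have [->|->|->] : [\/ d = -1, d = 0 | d = 1];
       [case: (ltgtP d 0) => ?; [apply: Or31|apply: Or33|apply: Or32]; lia| | |].
  exists AB; last by [].
  rewrite /= inE; apply/andP; split.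
    by apply/pred0P => a /=; rewrite !inE; case: eqP => // ->.
  by apply/eqP/ffunP => i; rewrite -(posw _ _ ww w0) xw.
- move=> [AB /=]; rewrite inE => /andP[dAB /eqP px] [ww w0]; split; first split => //.
    by move=> i; rewrite (posw _ _ ww w0) px.
  move=> l lK; rewrite ww// -[l]/(val (Ordinal lK)) incr_word_cell.
  by case: (_ \in _); case: (_ \in _).
Qed.

Lemma trivIset_word_event x :
  trivIset [set AB : conf | AB \in confs_at x] (fun AB => word_event AB `&` start_at0).
Proof.
move=> [A1 B1] [A2 B2] /=; rewrite !inE /= => /andP[d1 _] /andP[d2 _] [w [[w1 _] [w2 _]]].
have E (a : 'I_K) : (a \in A1)%:Z - (a \in B1)%:Z = (a \in A2)%:Z - (a \in B2)%:Z.
  by have := w1 a (ltn_ord a); rewrite w2// !incr_word_cell.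
by congr (_, _); apply/setP => a; move: (E a) (pred0P d1 a) (pred0P d2 a) => /=;
  case: (a \in A1); case: (a \in A2); case: (a \in B1); case: (a \in B2).
Qed.

(** A path from 0 to 0 goes up as often as it goes down. *)
Lemma sum_confs_at (x : {ffun 'I_k -> int}) (q : nat -> nat -> R) :
  (forall i : 'I_k, i.+1 = k -> x i = 0) ->
  \sum_(AB in confs_at x) q #|AB.1| #|AB.2| =
  \sum_(0 <= n < K.+1) #|confs N n x|%:R * q n n.
Proof.
move=> xlast.
have [k0 N0] : (0 < k /\ 0 < N)%N by move: K_gt0; rewrite muln_gt0 => /andP.
have cardK (C : {set 'I_K}) : (#|C| < K.+1)%N.
  by rewrite ltnS -[leqRHS]card_ord max_card.
have bal AB : AB \in confs_at x -> #|AB.1| = #|AB.2|.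
  rewrite inE => /andP[_ /eqP px].
  have k1 : (k.-1 < k)%N by rewrite prednK.
  have := xlast (Ordinal k1); rewrite -px /= prednK// => /(_ erefl).
  have E (C : {set 'I_K}) : (\sum_(a in C) cell_step a) (Ordinal k1) = #|C|%:Z.
    rewrite sum_ffunE (eq_bigr (fun=> 1)) ?sumr_const ?natz// => a _.
    by rewrite !ffunE -ltnS /= prednK// ltn_divLR// ltn_ord.
  by rewrite /grid_position !ffunE !E => /eqP; rewrite subr_eq0 => /eqP [].
rewrite (partition_big (fun AB : conf => Ordinal (cardK AB.1)) predT)//= big_mkord.
apply: eq_bigr => n _.
rewrite (eq_bigr (fun=> q n n)); last first.
  by move=> AB /andP[/bal <- /eqP <-].
rewrite mulr_natl -sumr_const; apply: eq_bigl => AB.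
rewrite -val_eqE /= /confs; case: (boolP (AB \in confs_at x)) => [ABx|].
  have := bal _ ABx; move: ABx; rewrite !inE => /andP[-> ->] /= <-.
  by do ?case: (_ == _).
rewrite !inE => /negbTE ABx /=; apply/esym/negP => /and4P[dd _ _ pp].
by rewrite dd pp in ABx.
Qed.

Lemma proba_big_incr l : (l < K)%N ->
  P0 [set w : cadlagZ R | ~ `|w (tau l.+1) - w (tau l)| <= 1] = (1 - (p 0 + p 1 + p (-1)))%:E.
Proof.
move=> lK.
have h0 := tau01 (ltnW lK); have h1 := tau01 lK.
pose I (z : int) := [set w : cadlagZ R | w (tau l.+1) - w (tau l) = z].
have mI z : measurable (I z) by exact: (measurable_incr [set z]).
have PI z : P0 (I z) = (p z)%:E by exact: proba_incr.
rewrite (_ : [set w | _] = ~` (I 0 `|` I 1 `|` I (-1))); last first.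
  apply/seteqP; split => w /=; rewrite /I/=.
    by move=> h [[|]|] e; apply: h; rewrite e.
  set d := w _ - w _ => h d1; apply: h.
  have : (d == 0) || (d == 1) || (d == -1) by lia.
  by move=> /orP[/orP[/eqP|/eqP]|/eqP]; [left; left|left; right|right].
rewrite probability_setC; last by repeat apply: measurableU.
rewrite !measureU//.
- transitivity (1 - ((p 0)%:E + (p 1)%:E + (p (-1))%:E))%E => //.
  by congr (1 - (_ + _ + _))%E; exact: PI.
- by apply/seteqP; split=> // w [/=]; rewrite /I /= => ->.
- exact: measurableU.
- by apply/seteqP; split=> // w [/=]; rewrite /I /= => -[|] ->.
Qed.

(** The contribution to grid_event of the paths whose increments over the fine cells are
    all -1, 0 or 1; truncated subtraction is harmless, since there are no
    configurations with 2n > K. *)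
Definition unit_incr_proba (x : {ffun 'I_k -> int}) : R :=
  \sum_(0 <= n < K.+1) #|confs N n x|%:R * (p 1 ^+ n * p (-1) ^+ n * p 0 ^+ (K - n - n)).

(** A union bound over the K fine cells controls the paths with a large increment. *)
Lemma grid_estimate (x : {ffun 'I_k -> int}) : (forall i : 'I_k, i.+1 = k -> x i = 0) ->
  0 <= fine (P0 (grid_event x)) - unit_incr_proba x <= K%:R * (1 - (p 0 + p 1 + p (-1))).
Proof.
move=> xlast; set V := unit_incr_proba x.
have mg := measurable_grid_event x; have m0 := measurable_start_at0.
have mgs := measurableI _ _ mg m0; have ms := measurable_unit_incr_event.
have PV : P0 (grid_event x `&` start_at0 `&` unit_incr_event) = V%:E.
  rewrite grid_event_words measure_bigcup_finType.
  - rewrite /V /unit_incr_proba.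
    rewrite -(sum_confs_at (fun a b => p 1 ^+ a * p (-1) ^+ b * p 0 ^+ (K - a - b)))//.
    rewrite -sumEFin; apply: eq_bigr => AB; rewrite inE => /andP[dAB _].
    apply: etrans (proba_word_event dAB).
    by apply: proba_start_at0I; exact: measurable_word_event.
  - by move=> AB; apply: measurableI => //; exact: measurable_word_event.
  - exact: trivIset_word_event.
have Pr : P0 (grid_event x) = (P0 ((grid_event x `&` start_at0) `\` unit_incr_event) + V%:E)%E.
  rewrite -PV -(proba_start_at0I mg); exact: measureDI.
have fr : P0 ((grid_event x `&` start_at0) `\` unit_incr_event) \is a fin_num.
  by rewrite fin_num_measure//; exact: measurableD.
rewrite Pr fineD// addrK fine_ge0//=.
rewrite -lee_fin fineK//.
pose F l := [set w : cadlagZ R | ~ `|w (tau l.+1) - w (tau l)| <= 1].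
have mF l : (l < K)%N -> measurable (F l).
  move=> lK; apply: (measurable_incr [set z : int | ~ `|z| <= 1]); apply: tau01 => //.
  exact: ltnW.
have sub : (grid_event x `&` start_at0) `\` unit_incr_event `<=` \bigcup_(l in `I_K) F l.
  move=> w [_ /= nsm]; apply: contrapT => nw; apply: nsm => l lK.
  by apply: contrapT => h; apply: nw; exists l.
apply: (le_trans (content_sub_fsum P0 (finite_II K) mF (measurableD mgs ms) sub)).
rewrite -fsbig_ord (eq_bigr (fun=> (1 - (p 0 + p 1 + p (-1)))%:E)); last first.
  by move=> l _; exact: proba_big_incr.
by rewrite sumEFin sumr_const card_ord mulr_natl.
Qed.
End grid.

(** * Refining the grid *)

Lemma confs_size_le k N n x : (0 < #|@confs k N n x|)%N -> (n + n <= k * N)%N.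
Proof.
rewrite card_gt0 => /set0Pn[[A B]]; rewrite inE /= => /and4P[dAB /eqP cA /eqP cB _].
rewrite -{1}cA -{1}cB; move: dAB; rewrite -(geq_leqif (leq_card_setU A B)) => /leq_trans; apply.
by rewrite -[leqRHS]card_ord max_card.
Qed.

Lemma pos_proba_itv (R : realType) k n x : (0 : R) <= @pos_proba R k n x <= 1.
Proof.
elim: n x => [|n IH] x /=; first by case: (x == 0); rewrite ?lexx ler01.
have s0 : (0:R) <= \sum_(i < k) \sum_(j < k) pos_proba n (x - unit_step k i + unit_step k j).
  apply: sumr_ge0 => i _; apply: sumr_ge0 => j _.
  by have /andP[] := IH (x - unit_step k i + unit_step k j).
rewrite mulr_ge0 ?invr_ge0 ?exprn_ge0//=.
case: k x IH s0 => [|k] x IH s0; first by rewrite big_ord0 mulr0.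
rewrite ler_pdivrMl ?exprn_gt0// mulr1.
apply: (@le_trans _ _ (\sum_(i < k.+1) \sum_(j < k.+1) 1)).
  apply: ler_sum => i _; apply: ler_sum => j _.
  by have /andP[] := IH (x - unit_step k.+1 i + unit_step k.+1 j).
by rewrite !sumr_const !card_ord -mulrnA -natrX expnS expn1.
Qed.

(** The single grid time is 1, where every balanced path is back at 0. *)
Lemma pos_proba_grid1 (R : realType) n : @pos_proba R 1 n 0 = 1.
Proof.
elim: n => [|n IH] /=; first by rewrite eqxx.
rewrite (eq_bigr (fun=> 1)) => [|i _]; last first.
  rewrite (eq_bigr (fun=> 1)) => [|j _]; first by rewrite sumr_const card_ord.
  by rewrite (ord1 i) (ord1 j) sub0r addNr IH.
by rewrite sumr_const card_ord expr1n invr1 mulr1.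
Qed.

Lemma cvg_pow (R : realType) (u : nat -> R) (l : R) n :
  u K @[K --> \oo] --> l -> u K ^+ n @[K --> \oo] --> l ^+ n.
Proof.
move=> ul; elim: n => [|n IH]; first by rewrite expr0; exact: cvg_cst.
by rewrite exprS; under eq_fun do rewrite exprS; exact: cvgM.
Qed.

Section limit.
Context {R : realType}.
Variables (jp jm : R) (P0 : probability (cadlagZ R) R).
Hypotheses (jp_ge0 : 0 <= jp) (jm_ge0 : 0 <= jm).
Hypothesis walk : random_walk_law jp jm P0.

Let p (K : nat) := incr_proba P0 K%:R^-1.

Lemma cvg_seq_at_right (f : R -> R) (l : R) :
  h^-1 * f h @[h --> 0^'+] --> l -> K%:R * f K%:R^-1 @[K --> \oo] --> l.
Proof.
move=> /cvg_at_rightP fl.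
have h0 : harmonic n @[n --> \oo] --> (0 : R) by exact: cvg_harmonic.
have := fl (@harmonic R) (conj (fun n => harmonic_gt0 n) h0).
rewrite -[in X in _ -> X]cvg_shiftS; apply: cvg_trans; apply: near_eq_cvg; apply: nearW => n.
by rewrite /harmonic /= invrK.
Qed.

Lemma cvg_up_rate : K%:R * p K 1 @[K --> \oo] --> jp.
Proof. by case: walk => _ _ _ [h _ _]; exact: (cvg_seq_at_right h). Qed.

Lemma cvg_down_rate : K%:R * p K (-1) @[K --> \oo] --> jm.
Proof. by case: walk => _ _ _ [_ h _]; exact: (cvg_seq_at_right h). Qed.

Lemma cvg_big_jump : K%:R * (1 - (p K 0 + p K 1 + p K (-1))) @[K --> \oo] --> 0.
Proof.
case: walk => _ _ _ [_ _ h]; have := cvg_seq_at_right h.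
rewrite -[in X in X -> _]cvg_shiftS -[in X in _ -> X]cvg_shiftS; apply: cvg_trans.
apply: near_eq_cvg; apply: nearW => K; congr (_ * _); apply: EFin_inj.
have K0 : (0 < 1 * K.+1)%N by rewrite mul1n.
have := proba_big_incr walk K0 (l := 0%N) K0.
rewrite !mul1n mul0r mul1r => E.
rewrite (_ : [set w : cadlagZ R | 1 < `|w _ - w 0| ] =
  [set w : cadlagZ R | ~ `|w K.+1%:R^-1 - w 0| <= 1]).
  by rewrite E.
by apply/seteqP; split => w /=; rewrite ltNge => /negP.
Qed.

(** The probability of a nonzero increment is 1/K times a quantity that tends to
    jp + jm. *)
Lemma cvg_no_jump : p K 0 @[K --> \oo] --> (1 : R).
Proof.
have inv0 : K%:R^-1 @[K --> \oo] --> (0 : R).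
  by rewrite -cvg_shiftS; exact: cvg_harmonic.
have H : 1 - K%:R^-1 * (K%:R * p K 1 + K%:R * p K (-1) +
      K%:R * (1 - (p K 0 + p K 1 + p K (-1)))) @[K --> \oo] --> 1 - 0 * (jp + jm + 0).
  apply: cvgB; first exact: cvg_cst.
  by apply: cvgM => //; apply: cvgD (cvgD cvg_up_rate cvg_down_rate) cvg_big_jump.
rewrite mul0r subr0 in H; apply: cvg_trans H; apply: near_eq_cvg; near=> K.
have K0 : K%:R != 0 :> R by rewrite pnatr_eq0 -lt0n; near: K; exact: nbhs_infty_gt.
by rewrite /=; field.
Unshelve. all: by end_near. Qed.

(** The parameter of the number of pairs of jumps on the grid with K cells: it plays the
    role of jp * jm, once p_0 ^ K has been factored out. *)
Definition rate_ratio (K : nat) : R := K%:R ^+ 2 * p K 1 * p K (-1) / p K 0 ^+ 2.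

Lemma cvg_rate_ratio : rate_ratio K @[K --> \oo] --> jp * jm.
Proof.
have o0 : (1 : R) ^+ 2 != 0 by rewrite expr1n oner_neq0.
have H : K%:R * p K 1 * (K%:R * p K (-1)) * (p K 0 ^+ 2)^-1 @[K --> \oo] -->
    jp * jm * (1 ^+ 2)^-1.
  apply: cvgM; first exact: cvgM cvg_up_rate cvg_down_rate.
  by apply: cvgV => //; exact: cvg_pow cvg_no_jump.
rewrite expr1n invr1 mulr1 in H.
apply: cvg_trans H; apply: near_eq_cvg; apply: nearW => K.
by rewrite /rate_ratio /=; congr (_ / _); ring.
Qed.

Definition rescaled_sum k (x : {ffun 'I_k -> int}) N : R :=
  \sum_(0 <= n < (k * N).+1) density N n x * rate_ratio (k * N) ^+ n.

Lemma unit_incr_probaE k N (x : {ffun 'I_k -> int}) : (0 < k * N)%N -> p (k * N) 0 != 0 ->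
  unit_incr_proba P0 N x = p (k * N) 0 ^+ (k * N) * rescaled_sum x N.
Proof.
move=> K0 p0; rewrite /unit_incr_proba /rescaled_sum big_distrr /=; apply: eq_bigr => n _.
have [/eqP c0|c0] := posnP #|confs N n x|.
  by rewrite /density (eqP c0) !mul0r mulr0.
have nK := confs_size_le c0; rewrite /density /rate_ratio -/p.
have -> : p (k * N) 0 ^+ (k * N) = p (k * N) 0 ^+ (k * N - n - n) * (p (k * N) 0 ^+ 2) ^+ n.
  by rewrite -exprM -exprD; congr (_ ^+ _); lia.
have K0' : (k * N)%:R != 0 :> R by rewrite pnatr_eq0 -lt0n.
rewrite exprM !exprMn exprVn !expr2 !exprMn.
have a0 : (k * N)%:R ^+ n != 0 :> R by rewrite expf_neq0.
have b0 : p (k * N) 0 ^+ n != 0 by rewrite expf_neq0.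
rewrite /p in b0 *; set a := (k * N)%:R ^+ n in a0 *.
set b := (incr_proba _ _ 0 ^+ n) in b0 *.
by field; rewrite a0 b0.
Qed.

Lemma cvg_mul_infty k : (0 < k)%N -> (k * N)%N @[N --> \oo] --> \oo.
Proof.
move=> k0 A [M _ MA]; exists M => // n /= Mn; apply: MA => /=.
by apply: (leq_trans Mn); rewrite leq_pmull.
Qed.

(** Dominated convergence: the densities are at most 1 / (n!)^2 and the ratio is
    eventually at most jp * jm + 1. *)
Lemma cvg_rescaled_sum k (x : {ffun 'I_k -> int}) : (0 < k)%N ->
  rescaled_sum x N @[N --> \oo] --> bessel_with (fun n => pos_proba n x) (jp * jm).
Proof.
move=> k0.
have cr : rate_ratio (k * N) @[N --> \oo] --> jp * jm.
  exact: (@cvg_comp _ _ _ (fun N => (k * N)%N) rate_ratio _ _ _ (cvg_mul_infty k0) cvg_rate_ratio).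
rewrite /rescaled_sum /bessel_with.
have -> : (fun n => weight n * (jp * jm) ^+ n * pos_proba n x) =
    (fun n => weight n * pos_proba n x * (jp * jm) ^+ n).
  by apply/funext => n; rewrite mulrAC.
apply: (@tannery _ (fun N n => density N n x * rate_ratio (k * N) ^+ n) _
   (fun n => weight n * (jp * jm + 1) ^+ n) (fun N => (k * N).+1)).
- near=> N => n.
  have kN : (0 < k * N)%N by rewrite muln_gt0 k0; near: N; exact: nbhs_infty_gt.
  rewrite normrM (ger0_norm (density_ge0 _ _ _)) ler_pM ?density_ge0//.
    exact: density_le.
  rewrite normrX lerXn2r ?nnegrE ?addr_ge0 ?mulr_ge0//.
  have : `|jp * jm - rate_ratio (k * N)| < 1.
    by near: N; move/cvgrPdist_lt : cr; apply.
  move=> /ltW h; have := ler_normB (jp * jm) (jp * jm - rate_ratio (k * N)).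
  rewrite subKr => /le_trans; apply.
  by rewrite ger0_norm ?mulr_ge0// lerD2l.
- by apply: cvg_series_bessel; rewrite addr_ge0 ?mulr_ge0.
- by move=> n; apply: cvgM; [exact: cvg_density|exact: cvg_pow].
- by apply: nearW => N; apply/leqW; rewrite leq_pmull.
Unshelve. all: by end_near. Qed.

Lemma grid_gap k (x : {ffun 'I_k -> int}) : (0 < k)%N ->
  (forall i : 'I_k, i.+1 = k -> x i = 0) ->
  fine (P0 (grid_event x)) - p (k * N) 0 ^+ (k * N) * rescaled_sum x N @[N --> \oo] --> 0.
Proof.
move=> k0 xlast.
pose err K := K%:R * (1 - (p K 0 + p K 1 + p K (-1))).
have cerr : err (k * N)%N @[N --> \oo] --> 0.
  exact: (@cvg_comp _ _ _ (fun N => (k * N)%N) err _ _ _ (cvg_mul_infty k0) cvg_big_jump).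
have cone : p (k * N) 0 @[N --> \oo] --> (1 : R).
  exact: (@cvg_comp _ _ _ (fun N => (k * N)%N) (p ^~ 0) _ _ _ (cvg_mul_infty k0) cvg_no_jump).
have c0 : (fun=> 0 : R) N @[N --> \oo] --> (0 : R) by exact: cvg_cst.
apply: (squeeze_cvgr _ c0 cerr); near=> N.
have kN : (0 < k * N)%N by rewrite muln_gt0 k0; near: N; exact: nbhs_infty_gt.
rewrite -unit_incr_probaE//; first exact: (grid_estimate walk).
have : `|1 - p (k * N) 0| < 1 by near: N; move/cvgrPdist_lt : cone; apply.
by apply: contraTneq => ->; rewrite subr0 normr1 ltxx.
Unshelve. all: by end_near. Qed.

(** Both grid events have a probability of the form p_0 ^ K times a convergent factor,
    up to o(1), with the same K = k * N: the bridge event is the grid event of the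
    one-point grid, refined into k * N cells.  Cross-multiplying removes p_0 ^ K. *)
Lemma grid_proba k (x : {ffun 'I_k -> int}) : (0 < k)%N ->
  (forall i : 'I_k, i.+1 = k -> x i = 0) ->
  fine (P0 (grid_event x)) * bessel (jp * jm) =
  fine (P0 (@grid_event R 1 0)) * bessel_with (fun n => pos_proba n x) (jp * jm).
Proof.
move=> k0 xlast.
pose z : {ffun 'I_1 -> int} := 0.
have g := grid_gap k0 xlast; have t := @cvg_rescaled_sum _ x k0.
have zlast (i : 'I_1) : i.+1 = 1%N -> z i = 0 by rewrite ffunE.
have g1 : fine (P0 (grid_event z)) - p (k * N) 0 ^+ (k * N) * rescaled_sum z (k * N)
    @[N --> \oo] --> 0.
  have := @cvg_comp _ _ _ (fun N => (k * N)%N) _ _ _ _ (cvg_mul_infty k0)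
    (@grid_gap 1 z isT zlast).
  apply: cvg_trans; apply: near_eq_cvg; apply: nearW => N.
  by rewrite /= mul1n.
have t1 : rescaled_sum z (k * N) @[N --> \oo] --> bessel (jp * jm).
  have := @cvg_comp _ _ _ (fun N => (k * N)%N) _ _ _ _ (cvg_mul_infty k0)
    (@cvg_rescaled_sum _ z isT).
  rewrite (_ : bessel_with _ _ = bessel (jp * jm))//; congr (limn (series _)).
  by apply/funext => n; rewrite /z pos_proba_grid1 mulr1.
apply/eqP; rewrite -subr_eq0; apply/eqP.
have L1 : fine (P0 (grid_event x)) * rescaled_sum z (k * N) -
      fine (P0 (grid_event z)) * rescaled_sum x N
    @[N --> \oo] --> fine (P0 (grid_event x)) * bessel (jp * jm) -
      fine (P0 (grid_event z)) * bessel_with (fun n => pos_proba n x) (jp * jm).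
  by apply: cvgB; apply: cvgM => //; exact: cvg_cst.
(* In this combination of the two errors the products that carry p_0 ^ K cancel. *)
have L2 :
   (fine (P0 (grid_event x)) - p (k * N) 0 ^+ (k * N) * rescaled_sum x N) * rescaled_sum z (k * N) -
   (fine (P0 (grid_event z)) - p (k * N) 0 ^+ (k * N) * rescaled_sum z (k * N)) * rescaled_sum x N
   @[N --> \oo] --> 0 * bessel (jp * jm) - 0 * bessel_with (fun n => pos_proba n x) (jp * jm).
  by apply: cvgB; apply: cvgM.
rewrite !mul0r subr0 in L2; apply: (cvg_unique _ L1) => //.
apply: cvg_trans L2; apply: near_eq_cvg; apply: nearW => N.
by rewrite /=; ring.
Qed.

End limit.

(** * Measurability of the insertion of a pair of jumps *)

Section counting.
Context {R : realType}.
Implicit Types (A : {fset R}) (r s t u : R) (U : jumpU R).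

Lemma count_leE A t : count_le A t = (\sum_(u <- A) (u <= t)%R)%N.
Proof.
rewrite /count_le card_fset_sum1 -big_fset_condE /=.
by rewrite big_mkcond /=; apply: eq_bigr => u _; case: (u <= t).
Qed.

Lemma count_leU1 A r t : r \notin A -> count_le (r |` A)%fset t = ((r <= t)%R + count_le A t)%N.
Proof. by move=> rA; rewrite !count_leE big_fsetU1. Qed.

(** Near r, only a jump at r itself can change the count. *)
Lemma near_count_le A r :
  \forall s \near r, count_le A s = (\sum_(u <- A) (u < r)%R + ((r \in A) && (r <= s)%R))%N.
Proof.
have H : \forall s \near r, forall u, u \in (A : seq R) -> u != r -> (u <= s) = (u < r).
  elim: (A : seq R) => [|a l IH]; first by near=> s.
  have [ar|ra|->] := ltgtP a r.
  - near=> s => u; rewrite inE => /orP[/eqP-> _|ul].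
      by rewrite ar; apply/ltW; near: s; exact: lt_nbhsr.
    by move: u ul; near: s.
  - near=> s => u; rewrite inE => /orP[/eqP-> _|ul].
      rewrite (lt_gtF ra); apply/negbTE; rewrite -ltNge; near: s; exact: lt_nbhsl.
    by move: u ul; near: s.
  - near=> s => u; rewrite inE => /orP[/eqP->|ul]; first by rewrite eqxx.
    by move: u ul; near: s.
near=> s; rewrite count_leE.
have Hs : forall u, u \in A -> u != r -> (u <= s) = (u < r) by near: s.
rewrite (_ : ((r \in A) && (r <= s)%R : nat) = \sum_(u <- A) ((u == r) && (r <= s)%R))%N.
  rewrite -big_split /=; apply: eq_big_seq => u uA.
  have [->|ur] := eqVneq u r; first by rewrite ltxx.
  by rewrite Hs// addn0.
case: (r <= s); rewrite ?andbF ?andbT; last first.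
  by rewrite big1// => u _; rewrite andbF.
under eq_bigr do rewrite andbT.
have [rA|rA] := boolP (r \in A).
  rewrite (big_fsetD1 r)//= eqxx big_seq big1 ?addn0// => u.
  by rewrite !inE => /andP[/negbTE ->].
rewrite big_seq big1// => u uA.
by case: eqP => // ur; rewrite -ur uA in rA.
Unshelve. all: by end_near. Qed.

Definition jump_time U r : bool := (r \in ups U) || (r \in downs U).

(** This expresses the absence of a jump at r by countably many conditions on the path,
    each of them a measurable rectangle in (U, r).  A jump is detected because up and
    down jumps never occur at the same time and so cannot compensate. *)
Lemma not_jump_timeP U r : ~~ jump_time U r <->
  exists ab : rat * rat, ratr ab.1 < r < ratr ab.2 /\
    forall q : rat, ab.1 <= q <= ab.2 -> jump_path U (ratr q) = jump_path U (ratr ab.1).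
Proof.
have [c near_path] : exists c : int, \forall s \near r,
    path_of U s = c + ((r \in ups U) && (r <= s))%:Z - ((r \in downs U) && (r <= s))%:Z.
  exists ((\sum_(u <- ups U) (u < r)%R)%N%:Z - (\sum_(u <- downs U) (u < r)%R)%N%:Z).
  have Hp := near_count_le (ups U) r; have Hm := near_count_le (downs U) r.
  near=> s; rewrite /= /jump_path (near Hp s)// (near Hm s)// !PoszD; ring.
have [e /= e0 He] := near_path.
have Hs s : r - e < s < r + e -> jump_path U s =
    c + ((r \in ups U) && (r <= s))%:Z - ((r \in downs U) && (r <= s))%:Z.
  move=> /andP[s1 s2]; apply: He => /=; rewrite ltr_distlC; apply/andP; split; lra.
split.
- rewrite /jump_time negb_or => /andP[/negbTE rp /negbTE rm].
  have [a] : exists a : rat, ratr a \in `]r - e, r[ by apply: rat_in_itvoo; lra.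
  rewrite in_itv /= => /andP[a1 a2].
  have [b] : exists b : rat, ratr b \in `]r, r + e[ by apply: rat_in_itvoo; lra.
  rewrite in_itv /= => /andP[b1 b2].
  exists (a, b) => /=; split; first by rewrite a2.
  move=> q; rewrite -!(ler_rat R) => /andP[aq qb].
  by rewrite !Hs; first (by rewrite rp rm); apply/andP; split; lra.
- move=> [[a b] /= [/andP[ar rb] cst]]; apply/negP => jr.
  have [x] : exists x : rat, ratr x \in `]Num.max (ratr a) (r - e), r[.
    by apply: rat_in_itvoo; rewrite gt_max ar /=; lra.
  rewrite in_itv /= gt_max => /andP[/andP[ax x1] x2].
  have [y] : exists y : rat, ratr y \in `]r, Num.min (ratr b) (r + e)[.
    by apply: rat_in_itvoo; rewrite lt_min rb /=; lra.
  rewrite in_itv /= lt_min => /andP[y1 /andP[yb y2]].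
  have : jump_path U (ratr x) = jump_path U (ratr y).
    rewrite cst; last by rewrite -!(ler_rat R); apply/andP; split; lra.
    by rewrite -(cst y)// -!(ler_rat R); apply/andP; split; lra.
  rewrite !Hs; [|apply/andP; split; lra|apply/andP; split; lra].
  rewrite (ltW y1) leNgt x2 /= !andbF !andbT.
  have := jr; rewrite /jump_time; have := jumpUP U; rewrite /jump_pair => /and4P[_ _ dU _].
  have : ~~ ((r \in ups U) && (r \in downs U)).
    by apply/negP => /andP[ru rd]; move/fdisjointP : dU => /(_ r ru); rewrite rd.
  by case: (r \in ups U); case: (r \in downs U) => //= _ _; lia.
Unshelve. all: by end_near. Qed.

End counting.

Section insertion.
Context {R : realType}.
Local Notation mR := (measurableTypeR R).
Implicit Types (r s t : R) (U : jumpU R).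

(** The first rule defining Psi, without the rule that removes jumps: almost every pair of
    times falls under it. *)
Definition insert_jumps (q : jumpU R * (mR * mR)) : jumpU R :=
  if (q.2.1 \notin ups q.1) && (q.2.2 \notin downs q.1) then
    insubd q.1 ((q.2.1 |` ups q.1)%fset, (q.2.2 |` downs q.1)%fset)
  else q.1.

Definition insertable (q : jumpU R * (mR * mR)) : bool :=
  [&& 0 < q.2.1 < 1, 0 < q.2.2 < 1, q.2.1 != q.2.2, ~~ jump_time q.1 q.2.1
    & ~~ jump_time q.1 q.2.2].

Lemma insert_jumpsE q : jumpU_val (insert_jumps q) =
  if insertable q then ((q.2.1 |` ups q.1)%fset, (q.2.2 |` downs q.1)%fset)
  else jumpU_val q.1.
Proof.
case: q => U [r s]; rewrite /insert_jumps /insertable /jump_time /=.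
have [rU|rU] /= := boolP (r \in ups U); first by rewrite !andbF.
have [sU|sU] /= := boolP (s \in downs U); first by rewrite orbT !andbF.
rewrite val_insubd orbF.
suff -> : jump_pair ((r |` ups U)%fset, (s |` downs U)%fset) =
   [&& 0 < r < 1, 0 < s < 1, r != s, r \notin downs U & s \notin ups U] by [].
have := jumpUP U; rewrite /jump_pair /= -/(ups U) -/(downs U) => /and4P[u01 d01 dUU cU].
rewrite !cardfsU1 rU sU !add1n eqSS cU andbT.
have allU1 (a : R) (A : {fset R}) : all (fun u => 0 < u < 1) A ->
    all (fun u => 0 < u < 1) (a |` A)%fset = (0 < a < 1).
  move=> /allP hA; apply/allP/idP => [|ha u]; first by apply; rewrite !inE eqxx.
  by rewrite !inE => /orP[/eqP ->|/hA].
rewrite !allU1//; congr [&& _, _ & _].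
by rewrite fdisjointU1X fdisjointXU fdisjointX1 dUU andbT !inE negb_or andbA.
Qed.

Lemma jump_path_insert q t : jump_path (insert_jumps q) t =
  if insertable q then jump_path q.1 t + (q.2.1 <= t)%R%:Z - (q.2.2 <= t)%R%:Z
  else jump_path q.1 t.
Proof.
rewrite /jump_path /ups /downs insert_jumpsE.
case: ifP => // /and5P[_ _ _]; rewrite /jump_time !negb_or => /andP[rU _] /andP[_ sD] /=.
by rewrite !count_leU1// !PoszD; ring.
Qed.

Lemma measurable_eval (t : R) (z : int) : measurable [set w : cadlagZ R | w t = z].
Proof.
have [t01|t01] := boolP (0 <= t <= 1).
  by apply: sub_sigma_algebra; exists t; split => //; exists z.
have E w : (w : cadlagZ R) t = 0 by have /asboolP[_ _] := cadlagZP w; apply.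
have [->|/eqP z0] := eqVneq z 0.
  by rewrite (_ : [set w | _] = setT)//; apply/seteqP; split=> w //= _; exact: E.
by rewrite (_ : [set w | _] = set0)//; apply/seteqP; split => w //=; rewrite E => /esym.
Qed.

Lemma measurable_jump_path_eq (t : R) (z : int) :
  measurable [set U : jumpU R | jump_path U t = z].
Proof. by exists [set w : cadlagZ R | w t = z]; [exact: measurable_eval|rewrite setTI]. Qed.

(** The countable description given by not_jump_timeP. *)
Lemma measurable_jump_time : measurable [set q : jumpU R * mR | jump_time q.1 q.2].
Proof.
rewrite -[X in measurable X]setCK; apply: measurableC.
rewrite (_ : ~` _ = \bigcup_(ab : rat * rat)
   ((\bigcap_(q in [set q : rat | ab.1 <= q <= ab.2])
      (\bigcup_(z : int) ([set U : jumpU R | jump_path U (ratr q) = z] `&`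
                          [set U : jumpU R | jump_path U (ratr ab.1) = z])))
    `*` `]ratr ab.1, ratr ab.2[)); last first.
  apply/seteqP; split => -[U r] /=.
    move=> /negP/not_jump_timeP[ab [rab h]]; exists ab => //; split => /=; last by rewrite in_itv.
    by move=> q /h E; exists (jump_path U (ratr ab.1)) => //; split.
  move=> [ab _ [/= h rab]]; apply/negP/not_jump_timeP; exists ab; split.
    by rewrite in_itv in rab.
  by move=> q /h[z _ [/= -> ->]].
apply: countable_bigcupT_measurable; first exact: countableP.
move=> ab; apply: measurableX => //; rewrite bigcap_mkcond.
rewrite -[X in measurable X]setCK setC_bigcap; apply: measurableC.
apply: countable_bigcupT_measurable; first exact: countableP.
move=> q; apply: measurableC; case: ifP => _ //.
apply: countable_bigcupT_measurable; first exact: countableP.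
by move=> z; apply: measurableI; exact: measurable_jump_path_eq.
Qed.

Let up (q : jumpU R * (mR * mR)) := q.2.1.
Let down (q : jumpU R * (mR * mR)) := q.2.2.

Let measurable_up : measurable_fun setT up.
Proof. by apply: measurableT_comp => //; exact: measurable_snd. Qed.

Let measurable_down : measurable_fun setT down.
Proof. by apply: measurableT_comp => //; exact: measurable_snd. Qed.

Lemma measurable_insertable : measurable [set q | insertable q].
Proof.
rewrite (_ : [set q | _] = (up @^-1` `]0, 1[) `&` (down @^-1` `]0, 1[) `&`
   (up \- down) @^-1` (~` [set 0]) `&`
   (fun q => (q.1, up q)) @^-1` (~` [set q : jumpU R * mR | jump_time q.1 q.2]) `&`
   (fun q => (q.1, down q)) @^-1` (~` [set q : jumpU R * mR | jump_time q.1 q.2])); last first.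
  apply/seteqP; split => -[U [r s]]; rewrite /insertable /up /down /= !in_itv /=.
    move=> /and5P[-> -> rs /negP ru /negP su]; do !split => //.
    by move=> /eqP; rewrite subr_eq0 (negbTE rs).
  move=> [[[[-> ->] rs] /negP ->] /negP ->]; rewrite !andbT /=.
  by apply/eqP => rs'; apply: rs; rewrite rs' subrr.
have mjt := measurable_jump_time.
repeat apply: measurableI; rewrite -[X in measurable X]setTI.
- exact: measurable_up.
- exact: measurable_down.
- by apply: (measurable_funB measurable_up measurable_down) => //; exact: measurableC.
- by apply: (measurable_fun_pair measurable_fst measurable_up) => //; exact: measurableC.
- by apply: (measurable_fun_pair measurable_fst measurable_down) => //; exact: measurableC.
Qed.

Lemma measurable_insert_jumps : measurable_fun setT insert_jumps.
Proof.
suff h : measurable_fun setT (@path_of R \o insert_jumps).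
  by move=> _ _ [B mB <-]; rewrite !setTI; have := h measurableT B mB; rewrite setTI.
apply: (measurability (@cylinders R)) => // _ [_ [t [t01 [z ->]]] <-]; rewrite setTI.
have mg := measurable_insertable.
rewrite (_ : _ @^-1` _ = ([set q | insertable q] `&` \bigcup_(bc : bool * bool)
   ([set q | jump_path q.1 t = z - bc.1%:Z + bc.2%:Z] `&` [set q | (up q <= t) = bc.1] `&`
    [set q | (down q <= t) = bc.2])) `|`
    (~` [set q | insertable q] `&` [set q | jump_path q.1 t = z])); last first.
  apply/seteqP; split => q; rewrite /= jump_path_insert.
    case: ifP => hq qz; last by right; split.
    left; split => //; exists (up q <= t, down q <= t) => //=; split => //; split => //.
    rewrite -qz /up /down /=; ring.
  case=> -[hq].
    move=> [[b c] _ [[/= h1 h2] h3]]; rewrite hq; move: h1 h2 h3.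
    rewrite /up /down => -> -> ->; ring.
  by case: ifP.
have meq y : measurable [set q : jumpU R * (mR * mR) | jump_path q.1 t = y].
  have mf : measurable_fun [set: jumpU R * (mR * mR)] fst by exact: measurable_fst.
  by have := mf measurableT _ (measurable_jump_path_eq t y); rewrite setTI.
have mle (f : jumpU R * (mR * mR) -> R) b :
    measurable_fun setT f -> measurable [set q | (f q <= t) = b].
  move=> mf; rewrite (_ : [set q | _] = f @^-1` (if b then `]-oo, t] else `]t, +oo[)%classic).
    by rewrite -[X in measurable X]setTI; apply: mf => //; case: b.
  apply/seteqP; split => q /=; case: b; rewrite /= in_itv /= ?andbT// ltNge.
    by move=> ->.
  by move=> /negbTE.
apply: measurableU; apply: measurableI => //; last exact: measurableC.
apply: countable_bigcupT_measurable; first exact: countableP.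
by move=> [b c]; apply: measurableI; [apply: measurableI|] => //; exact: mle.
Qed.

End insertion.

(** * The law of n pairs of independent uniform jumps *)

Lemma product_measure_null d1 d2 (T1 : measurableType d1) (T2 : measurableType d2)
    (R : realType) (m1 : {measure set T1 -> \bar R}) (m2 : {sigma_finite_measure set T2 -> \bar R})
    (A : set (T1 * T2)) :
  (forall x, m2 (xsection A x) = 0%E) -> (m1 \x m2)%E A = 0%E.
Proof. by move=> A0; rewrite /product_measure1 integral0_eq// => x _ /=. Qed.

Section uniform.
Context {R : realType}.

Local Notation mR := (measurableTypeR R).

Definition unif01 : probability mR R := uniform_prob (@ltr01 R).
Arguments unif01 : simpl never.

Lemma unif01E (A : set mR) : measurable A -> unif01 A = lebesgue_measure (A `&` `[0, 1]).
Proof.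
move=> mA.
transitivity (\int[lebesgue_measure]_(x in A) (uniform_pdf 0 1 x)%:E)%E => //.
rewrite integral_uniform_pdf.
rewrite (eq_integral (cst 1%:E)); last first.
  move=> x /set_mem [_]; rewrite /= in_itv /= /uniform_pdf => ->.
  by rewrite subr0 invr1.
by rewrite integral_cst ?mul1e//; exact: measurableI.
Qed.

Lemma unif01_sub (A : set mR) : measurable A -> A `<=` `[0, 1] -> unif01 A = lebesgue_measure A.
Proof. by move=> mA A01; rewrite unif01E// setIidl. Qed.

Lemma unif01_finite (A : set mR) : measurable A -> finite_set A -> unif01 A = 0%E.
Proof.
move=> mA fA; rewrite unif01E//; apply: countable_lebesgue_measure0.
by apply: sub_countable (finite_set_countable fA); apply: subset_card_le; exact: subIsetl.
Qed.

Lemma unif01_itv (a b : R) : 0 <= a -> a <= b -> b <= 1 -> unif01 `]a, b]%classic = (b - a)%:E.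
Proof.
move=> a0 ab b1; rewrite unif01_sub//.
  rewrite lebesgue_measure_itv /= lte_fin; case: (ltP a b) => // ba.
  by have -> : a = b; [apply/le_anti; rewrite ab ba|rewrite subrr].
by move=> x /=; rewrite !in_itv /= => /andP[x1 x2]; apply/andP; split; lra.
Qed.

Lemma unif01_out : unif01 (~` `]0, 1[) = 0%E.
Proof.
rewrite probability_setC// unif01_sub//.
  by rewrite lebesgue_measure_itv /= lte_fin ltr01 oppr0 adde0 subee.
by move=> x /=; rewrite !in_itv /= => /andP[x1 x2]; apply/andP; split; lra.
Qed.

HB.instance Definition _ := isMeasurableFun.Build _ _ _ _ (@insert_jumps R)
  (@measurable_insert_jumps R).

(** Building the law one pair at a time makes the coupling of n and n.+1 pairs part of
    the definition. *)
Fixpoint pairs_law (n : nat) : probability (jumpU R) R :=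
  if n is m.+1 then distribution (pairs_law m \x (unif01 \x unif01))%E (@insert_jumps R)
  else \d_(JumpU (jump_pair0 R)).

End uniform.

Section pairs_grid.
Context {R : realType}.
Local Notation mR := (measurableTypeR R).

Lemma finite_jump_time (U : jumpU R) : finite_set [set r : mR | jump_time U r].
Proof.
rewrite (_ : [set r | _] = [set` ups U] `|` [set` downs U]).
  by rewrite finite_setU; split; exact: finite_fset.
by apply/seteqP; split => r /=; rewrite /jump_time => /orP.
Qed.

Lemma measurable_finite (A : set mR) : finite_set A -> measurable A.
Proof. by move=> /finite_set_countable; exact: countable_measurable. Qed.

Lemma unif01X_null (A B : set mR) : measurable A -> measurable B ->
  unif01 A = 0%E \/ unif01 B = 0%E -> (unif01 \x unif01)%E (A `*` B) = 0%E.
Proof.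
move=> mA mB AB; rewrite product_measure1E//; case: AB => AB.
  by rewrite [X in (X * _)%E](_ : _ = 0%E) ?mul0e.
by rewrite [X in (_ * X)%E](_ : _ = 0%E) ?mule0.
Qed.

(** For a fixed configuration the forbidden values of each of the two times form a null
    set: 0, 1 and the finitely many jump times.  The diagonal is null for the product of
    two diffuse laws. *)
Lemma insertable_full (mu : probability (jumpU R) R) :
  (mu \x (unif01 \x unif01))%E (~` [set q | insertable q]) = 0%E.
Proof.
pose M : probability (jumpU R * (mR * mR))%type R := (mu \x (unif01 \x unif01))%E.
have mN : measurable (~` [set q | @insertable R q]).
  by apply: measurableC; exact: measurable_insertable.
apply/(negligibleP M mN).
have mjt := @measurable_jump_time R.
have oo1 : measurable (~` (`]0, 1[ : set mR)) by exact: measurableC.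
have negl_out (i : bool) : M.-negligible [set q | ~ 0 < (if i then q.2.1 else q.2.2) < 1].
  apply/negligibleP.
    rewrite (_ : [set q | _] =
      (fun q : jumpU R * (mR * mR) => (if i then q.2.1 else q.2.2) : mR) @^-1` (~` `]0, 1[)).
      rewrite -[X in measurable X]setTI; case: i.
        by apply: (measurableT_comp (@measurable_fst _ _ mR mR) measurable_snd) => //.
      by apply: (measurableT_comp (@measurable_snd _ _ mR mR) measurable_snd) => //.
    by apply/seteqP; split => q /=; rewrite in_itv.
  apply: product_measure_null => U.
  case: i.
    rewrite (_ : xsection _ _ = (~` `]0, 1[ : set mR) `*` [set: mR]).
      by apply: unif01X_null => //; left; exact: unif01_out.
    by apply/seteqP; split => -[r s]; rewrite /xsection /= in_itv /= ?inE /=; [split|case].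
  rewrite (_ : xsection _ _ = [set: mR] `*` (~` `]0, 1[ : set mR)).
    by apply: unif01X_null => //; right; exact: unif01_out.
  by apply/seteqP; split => -[r s]; rewrite /xsection /= in_itv /= ?inE /=; [split|case].
have negl_jump (i : bool) : M.-negligible [set q | jump_time q.1 (if i then q.2.1 else q.2.2)].
  apply/negligibleP.
    rewrite (_ : [set q | _] =
      (fun q : jumpU R * (mR * mR) => (q.1, (if i then q.2.1 else q.2.2) : mR)) @^-1`
       [set q : jumpU R * mR | jump_time q.1 q.2])//.
    rewrite -[X in measurable X]setTI; case: i.
      by apply: (measurable_fun_pair measurable_fst
        (measurableT_comp (@measurable_fst _ _ mR mR) measurable_snd)) => //.
    by apply: (measurable_fun_pair measurable_fst
        (measurableT_comp (@measurable_snd _ _ mR mR) measurable_snd)) => //.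
  apply: product_measure_null => U.
  have fJ := finite_jump_time U; have mJ := measurable_finite fJ.
  case: i.
    rewrite (_ : xsection _ _ = [set r : mR | jump_time U r] `*` [set: mR]).
      by apply: unif01X_null => //; left; exact: unif01_finite.
    by apply/seteqP; split => -[r s]; rewrite /xsection /= ?inE /=; [split|case].
  rewrite (_ : xsection _ _ = [set: mR] `*` [set r : mR | jump_time U r]).
    by apply: unif01X_null => //; right; exact: unif01_finite.
  by apply/seteqP; split => -[r s]; rewrite /xsection /= ?inE /=; [split|case].
have negl_diag : M.-negligible [set q | q.2.1 = q.2.2].
  apply/negligibleP.
    rewrite (_ : [set q | _] =
      ((fun q : jumpU R * (mR * mR) => q.2.1) \- (fun q => q.2.2)) @^-1` [set 0]).
      rewrite -[X in measurable X]setTI.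
      apply: (measurable_funB
        (measurableT_comp (@measurable_fst _ _ mR mR) measurable_snd)
        (measurableT_comp (@measurable_snd _ _ mR mR) measurable_snd)) => //.
    apply/seteqP; split => q /= => [->|/eqP]; first by rewrite subrr.
    by rewrite subr_eq0 => /eqP.
  apply: product_measure_null => U; apply: product_measure_null => r.
  rewrite (_ : xsection _ _ = [set r]); first by apply: unif01_finite => //; exact: measurable_finite.
  apply/seteqP; split => s; rewrite /xsection /=.
    by move=> /set_mem /= /set_mem /= ->.
  by move=> ->; apply/mem_set/mem_set.
apply: (negligibleS _ (negligibleU (negligibleU (negligibleU (negl_out true) (negl_out false))
   (negligibleU (negl_jump true) (negl_jump false))) negl_diag)).
move=> [U [r s]] /=; rewrite /insertable /= => /negP.
rewrite !negb_and !negbK -!negb_and => /or4P[/negP|/negP|/eqP|/orP[]].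
- by left; left; left.
- by left; left; right.
- by right.
- by left; right; left.
- by left; right; right.
Qed.

Definition grid_jumps k (x : {ffun 'I_k -> int}) : set (jumpU R) :=
  [set U | forall i : 'I_k, jump_path U (i.+1%:R / k%:R) = x i].

Lemma measurable_grid_jumps k (x : {ffun 'I_k -> int}) : measurable (grid_jumps x).
Proof.
exists (grid_event (R := R) x); first exact: measurable_grid_event.
by rewrite setTI.
Qed.

Definition block k (i : nat) : set mR := `]i%:R / k%:R, i.+1%:R / k%:R]%classic.

(** A jump at time r is seen at the grid times m.+1 / k with r <= m.+1 / k; blocks are
    closed on the right so that this only depends on the block of r. *)
Lemma block_step k (i : nat) (r : R) (m : 'I_k) : block k i r ->
  ((r <= m.+1%:R / k%:R)%R)%:Z = unit_step k i m.
Proof.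
have k0 : (0 : R) < k%:R by rewrite ltr0n; case: k m => // -[].
rewrite /block /= in_itv /= => /andP[ir ri]; rewrite ffunE; case: (leqP i m) => im.
  congr (nat_of_bool _)%:Z; apply: (le_trans ri).
  by rewrite ler_pM2r ?invr_gt0// ler_nat.
congr (nat_of_bool _)%:Z; apply/negbTE; rewrite -ltNge; apply: le_lt_trans ir.
by rewrite ler_pM2r ?invr_gt0// ler_nat.
Qed.

Lemma block_exists k (r : R) : (0 < k)%N -> 0 < r <= 1 -> exists i : 'I_k, block k i r.
Proof.
move=> k0 /andP[r0 r1].
have ex : exists m, r <= m.+1%:R / k%:R by exists k.-1; rewrite prednK// divff// pnatr_eq0 -lt0n.
case: (ex_minnP ex) => m rm mmin.
have mk : (m < k)%N.
  by rewrite -(prednK k0) ltnS; apply: mmin; rewrite prednK// divff// pnatr_eq0 -lt0n.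
exists (Ordinal mk); rewrite /block /= in_itv /= rm andbT.
case: m rm mmin mk => [|m] rm mmin mk; first by rewrite mul0r.
by rewrite ltNge; apply/negP => /mmin; rewrite ltnn.
Qed.

Lemma block_inj k (i j : nat) (r : R) : block k i r -> block k j r -> i = j.
Proof.
wlog ij : i j / (i <= j)%N by move=> H; case/orP: (leq_total i j) => ? ? ?; [|apply/esym]; exact: H.
have [->|k0] := posnP k.
  rewrite /block /= !in_itv /= invr0 !mulr0 => /andP[h1 h2].
  by have := lt_le_trans h1 h2; rewrite ltxx.
rewrite /block /= !in_itv /= => /andP[_ h1] /andP[h2 _].
have := lt_le_trans h2 h1; rewrite ltr_pM2r ?invr_gt0 ?ltr0n// ltr_nat ltnS => ji.
by apply/eqP; rewrite eqn_leq ij ji.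
Qed.

Lemma unif01_block k (i : 'I_k) : unif01 (block k i) = (k%:R^-1)%:E.
Proof.
have k0 : (0 : R) < k%:R by rewrite ltr0n; case: k i => // -[].
rewrite unif01_itv.
- by rewrite -mulrBl -natrB// subSnn mul1r.
- by rewrite divr_ge0.
- by rewrite ler_pM2r ?invr_gt0// ler_nat.
- by rewrite ler_pdivrMr// mul1r ler_nat.
Qed.

(** Whether the path with the added pair passes through x only depends on the old
    path and on the blocks that contain the two new times. *)
Lemma insert_grid_jumps k (x : {ffun 'I_k -> int}) : (0 < k)%N ->
  @insert_jumps R @^-1` grid_jumps x `&` [set q | insertable q] =
  (\bigcup_(ij : 'I_k * 'I_k) (grid_jumps (x - unit_step k ij.1 + unit_step k ij.2) `*`
     (block k ij.1 `*` block k ij.2))) `&` [set q | insertable q].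
Proof.
move=> k0; have fE (a b : {ffun 'I_k -> int}) m : (x - a + b) m = x m - a m + b m.
  by rewrite !ffunE.
apply/seteqP; split => -[U [r s]] /= [h ins]; split => //.
  have /and5P[/= r01 s01 _ _ _] := ins.
  have [i hi] : exists i : 'I_k, block k i r.
    by apply: block_exists => //; case/andP: r01 => -> /ltW ->.
  have [j hj] : exists i : 'I_k, block k i s.
    by apply: block_exists => //; case/andP: s01 => -> /ltW ->.
  exists (i, j) => //=; split => // m.
  rewrite fE -h jump_path_insert ins /= -(block_step m hi) -(block_step m hj).
  by rewrite /=; ring.
move: h => [[i j] _ [/= hU [hi hj]]] m; rewrite jump_path_insert ins /=.
rewrite hU (block_step m hi) (block_step m hj) fE; ring.
Qed.

(** The recursion that defines pos_proba, obtained by splitting the square of the two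
    new times into products of blocks. *)
Lemma pairs_law_grid n k (x : {ffun 'I_k -> int}) : (0 < k)%N ->
  @pairs_law R n (grid_jumps x) = (pos_proba n x)%:E.
Proof.
move=> k0; elim: n x => [|n IH] x.
  rewrite /= diracE; congr ((nat_of_bool _)%:R%:E).
  have E0 t : jump_path (JumpU (jump_pair0 R)) t = 0.
    by rewrite /jump_path /ups /downs /= !count_leE !big_seq_fset0 subrr.
  apply/idP/eqP => [/set_mem h|->].
    by apply/ffunP => i; rewrite -h E0 ffunE.
  by apply/mem_set => i; rewrite E0 ffunE.
pose M : probability (jumpU R * (mR * mR))%type R := (@pairs_law R n \x (unif01 \x unif01))%E.
have mI := @measurable_insertable R; have fI := insertable_full (@pairs_law R n).
transitivity (M (@insert_jumps R @^-1` grid_jumps x)) => //.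
rewrite -(probaI_full (P := M) _ mI fI); last first.
  rewrite -[X in measurable X]setTI; apply: measurable_insert_jumps => //.
  exact: measurable_grid_jumps.
have mB (i : nat) : measurable (block k i) by exact: measurable_itv.
have mF (ij : 'I_k * 'I_k) : measurable (grid_jumps (x - unit_step k ij.1 + unit_step k ij.2) `*`
     (block k ij.1 `*` block k ij.2)).
  by apply: measurableX; [exact: measurable_grid_jumps|exact: measurableX].
rewrite insert_grid_jumps// (probaI_full (P := M) _ mI fI); last first.
  exact: countable_bigcupT_measurable.
rewrite (_ : \bigcup_ij _ = \bigcup_(ij in [set ij : 'I_k * 'I_k | ij \in predT])
   (grid_jumps (x - unit_step k ij.1 + unit_step k ij.2) `*`
     (block k ij.1 `*` block k ij.2))); last first.
  by apply/seteqP; split => q [ij _ h]; exists ij.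
rewrite measure_bigcup_finType//; last first.
  move=> [i j] [i' j'] _ _ [[U [r s]] /= [[_ [ri sj]] [_ [ri' sj']]]].
  by congr (_, _); apply/val_inj; [exact: block_inj ri ri'|exact: block_inj sj sj'].
rewrite (eq_bigr (fun ij : 'I_k * 'I_k =>
    ((k%:R ^+ 2)^-1 * pos_proba n (x - unit_step k ij.1 + unit_step k ij.2))%:E)); last first.
  move=> [i j] _ /=.
  transitivity (@pairs_law R n (grid_jumps (x - unit_step k i + unit_step k j)%R) *
     (unif01 (block k i) * unif01 (block k j)))%E.
    have mg := measurable_grid_jumps (x - unit_step k i + unit_step k j).
    have mBB := measurableX (mB i) (mB j).
    pose V : probability (mR * mR)%type R := (unif01 \x unif01)%E.
    apply: etrans (product_measure1E (@pairs_law R n) V mg mBB) _.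
    by congr (_ * _)%E; exact: product_measure1E.
  by rewrite IH !unif01_block -!EFinM; congr (_%:E); rewrite expr2 invfM mulrC.
rewrite sumEFin -big_distrr /=; congr (_ * _)%:E.
by rewrite (pair_big predT predT).
Qed.

End pairs_grid.

(** * Dyadic grids determine a law on jump configurations *)

Section generation.
Context {R : realType}.
Implicit Types (U : jumpU R).

(** Each event fixes the path on a whole grid, so that two of them are either disjoint or
    nested; set0 and setT make this a pi-system that covers the space. *)
Definition dyadic_grids : set (set (jumpU R)) :=
  [set A | [\/ A = set0, A = setT | exists m (x : {ffun 'I_(2 ^ m) -> int}), A = grid_jumps x]].

Lemma setI_closed_dyadic_grids : setI_closed dyadic_grids.
Proof.
have grid_case m m' (x : {ffun 'I_(2 ^ m) -> int}) (x' : {ffun 'I_(2 ^ m') -> int}) :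
    (m <= m')%N -> dyadic_grids (grid_jumps (R := R) x `&` grid_jumps x').
  move=> mm'.
  have [->|/set0P[U [Ux Ux']]] := eqVneq (grid_jumps (R := R) x `&` grid_jumps x') set0.
    exact: Or31.
  apply: Or33; exists m', x'; apply/seteqP; split => V; first by case.
  move=> Vx'; split=> // i.
  have ti : (i.+1 * 2 ^ (m' - m)).-1.+1 = (i.+1 * 2 ^ (m' - m))%N.
    by rewrite prednK// muln_gt0 expn_gt0.
  have lt' : ((i.+1 * 2 ^ (m' - m)).-1 < 2 ^ m')%N.
    by rewrite ti -{2}(subnKC mm') expnD leq_mul2r ltn_ord orbT.
  have tE : i.+1%:R / (2 ^ m)%:R = (Ordinal lt').+1%:R / (2 ^ m')%:R :> R.
    have p2 p : (2 ^ p)%:R != 0 :> R by rewrite pnatr_eq0 -lt0n expn_gt0.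
    rewrite /= ti -(subnKC mm') expnD addKn !natrM; move: (p2 m) (p2 (m' - m)%N).
    by move=> h1 h2; rewrite -mulf_div divff ?mulr1.
  by rewrite -(Ux i) tE (Vx' (Ordinal lt')) (Ux' (Ordinal lt')).
move=> A B [-> _|->|[m [x ->]]]; first by rewrite set0I; exact: Or31.
  by rewrite setTI.
move=> [->|->|[m' [x' ->]]]; first by rewrite setI0; exact: Or31.
  by rewrite setIT; apply: Or33; exists m, x.
by case/orP: (leq_total m m') => mm'; [|rewrite setIC]; exact: grid_case.
Qed.

Let sT := g_sigma_algebraType dyadic_grids.

Lemma dyadic_grid_time m (i : nat) (z : int) : (i < 2 ^ m)%N ->
  measurable ([set U | jump_path U (i.+1%:R / (2 ^ m)%:R) = z] : set sT).
Proof.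
move=> im.
rewrite (_ : [set U | _] = \bigcup_(x : {ffun 'I_(2 ^ m) -> int})
   (if x (Ordinal im) == z then grid_jumps x else set0)).
  apply: countable_bigcupT_measurable; first exact: countableP.
  move=> x; case: ifP => // _; apply: sub_sigma_algebra; apply: Or33.
  by exists m, x.
apply/seteqP; split => U /=.
  move=> Uz; exists [ffun j : 'I_(2 ^ m) => jump_path U (j.+1%:R / (2 ^ m)%:R)] => //.
  by rewrite ffunE /= Uz eqxx => j; rewrite ffunE.
by move=> [x _]; case: ifP => // /eqP xz /(_ (Ordinal im)) ->.
Qed.

Lemma jump_path_right_cst U (t : R) : exists M : nat, forall m, (M <= m)%N ->
  forall s, t < s <= t + ((2 ^ m)%:R)^-1 -> jump_path U s = jump_path U t.
Proof.
have [e e0 He] : exists2 e : R, 0 < e & forall s, t < s < t + e -> jump_path U s = jump_path U t.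
  have Hp := near_count_le_right (ups U) t; have Hm := near_count_le_right (downs U) t.
  have : \forall s \near t^'+, jump_path U s = jump_path U t.
    by near=> s; rewrite /jump_path (near Hp s) ?(near Hm s).
  move=> [e /= e0 He]; exists e => // s /andP[ts se]; apply: He => //=.
  by rewrite ltr_distlC; apply/andP; split; lra.
exists (Num.truncn e^-1).+1 => m em s /andP[ts st]; apply: He; rewrite ts /=.
apply: (le_lt_trans st); rewrite ltrD2l invf_plt ?posrE// ?ltr0n ?expn_gt0//.
have := truncnS_gt e^-1 => /lt_trans; apply.
by rewrite ltr_nat; apply: (leq_ltn_trans em); exact: ltn_expl.
Unshelve. all: by end_near. Qed.

(** By right-continuity the value at t is the eventual value at the dyadic times that
    approach t from the right. *)
Lemma jump_path_generated (t : R) (z : int) : 0 <= t <= 1 ->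
  measurable ([set U | jump_path U t = z] : set sT).
Proof.
move=> /andP[t0]; rewrite le_eqVlt => /orP[/eqP->|t1].
  by have := @dyadic_grid_time 0 0 z isT; rewrite expn0 divr1.
(* The grid time of index idx m is the first time of level m strictly after t. *)
pose idx m := Num.truncn (t * (2 ^ m)%:R).
have p2 m : (0 : R) < (2 ^ m)%:R by rewrite ltr0n expn_gt0.
have h0 m : 0 <= t * (2 ^ m)%:R by rewrite mulr_ge0.
have lo m : t < (idx m).+1%:R / (2 ^ m)%:R.
  by rewrite ltr_pdivlMr// truncnS_gt.
have hi m : (idx m).+1%:R / (2 ^ m)%:R <= t + ((2 ^ m)%:R)^-1.
  by rewrite -natr1 mulrDl mul1r lerD2r ler_pdivrMr// truncn_le.
have idx_lt m : (idx m < 2 ^ m)%N.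
  rewrite -(ltr_nat R); apply: (@le_lt_trans _ _ (t * (2 ^ m)%:R)); first by rewrite truncn_le.
  by rewrite gtr_pMl.
rewrite (_ : [set U | _] = \bigcup_M \bigcap_(m in [set m | (M <= m)%N])
   [set U | jump_path U ((idx m).+1%:R / (2 ^ m)%:R) = z]).
  apply: bigcupT_measurable => M; apply: bigcap_measurable; first by exists M => /=.
  by move=> m _; exact: dyadic_grid_time.
apply/seteqP; split => U /=.
  have [M HM] := jump_path_right_cst U t.
  by move=> Uz; exists M => // m /= Mm; rewrite (HM m)// lo hi.
move=> [M _ HU]; have [M' HM'] := jump_path_right_cst U t.
rewrite -(HM' (maxn M M') (leq_maxr _ _) ((idx (maxn M M')).+1%:R / (2 ^ (maxn M M'))%:R)).
  by apply: HU; rewrite /= leq_maxl.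
by rewrite lo hi.
Qed.

Lemma measurable_dyadic_grids :
  (measurable : set (set (jumpU R))) = <<s dyadic_grids >>.
Proof.
apply/seteqP; split.
  move=> _ [B mB <-]; rewrite setTI.
  have : measurable_fun [set: sT] (@path_of R : sT -> cadlagZ R).
    apply: (measurability (@cylinders R)) => // _ [_ [t [t01 [z ->]]] <-].
    by rewrite setTI; exact: jump_path_generated.
  by move=> /(_ measurableT B mB); rewrite setTI.
apply: smallest_sub; first exact: sigma_algebra_measurable.
by move=> _ [->|->|[m [x ->]]] //; exact: measurable_grid_jumps.
Qed.

Lemma jumpU_measure_unique (m1 m2 : {measure set (jumpU R) -> \bar R}) :
  m1 setT = 1%E -> m2 setT = 1%E ->
  (forall m (x : {ffun 'I_(2 ^ m) -> int}), m1 (grid_jumps x) = m2 (grid_jumps x)) ->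
  forall A, measurable A -> m1 A = m2 A.
Proof.
move=> m11 m21 m12 A mA.
apply: (measure_unique dyadic_grids (fun=> setT)) => //.
- exact: measurable_dyadic_grids.
- exact: setI_closed_dyadic_grids.
- by move=> _; exact: Or32.
- by rewrite bigcup_const.
- by move=> _ [->|->|[m [x ->]]]; rewrite ?measure0// m11 m21.
- by move=> _; rewrite m11 ltry.
Qed.

End generation.

(** * The bridge as a mixture *)

Section mixture.
Context {R : realType}.
Variable la : R.
Hypothesis la_ge0 : 0 <= la.

Lemma mixture_weight_ge0 n : 0 <= weight n * la ^+ n :> R.
Proof. by rewrite mulr_ge0 ?weight_ge0 ?exprn_ge0. Qed.

Lemma inv_bessel_ge0 : 0 <= (bessel la)^-1.
Proof. by rewrite invr_ge0 ltW// bessel_gt0. Qed.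

Definition mixture : set (jumpU R) -> \bar R :=
  mscale (NngNum inv_bessel_ge0)
    (mseries (fun n => mscale (NngNum (mixture_weight_ge0 n)) (pairs_law n)) 0).

HB.instance Definition _ := Measure.on mixture.

Lemma eseries_bessel_with (g : nat -> R) C : (forall n, `|g n| <= C * n.+1%:R) ->
  (\sum_(0 <= n <oo) (weight n * la ^+ n)%:E * (g n)%:E = (bessel_with g la)%:E)%E.
Proof.
move=> gC; rewrite /bessel_with -EFin_lim; last exact: cvg_series_bessel_with gC.
congr (limn _); apply/funext => N; rewrite /= -sumEFin.
by apply: eq_bigr => n _; rewrite -EFinM.
Qed.

Lemma mixtureE (A : set (jumpU R)) (g : nat -> R) :
  (forall n, pairs_law n A = (g n)%:E) -> (forall n, `|g n| <= 1) ->
  mixture A = (bessel_with g la / bessel la)%:E.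
Proof.
move=> gA g1; rewrite /mixture /mscale /mseries /= mulrC EFinM; congr (_ * _)%E.
rewrite -(@eseries_bessel_with g 1); last first.
  by move=> n; apply: (le_trans (g1 n)); rewrite mul1r ler1n.
by apply: eq_eseriesr => n _; congr (_ * _)%E; exact: gA.
Qed.

Lemma mixture_setT : mixture setT = 1%E.
Proof.
rewrite (@mixtureE _ (fun=> 1)) ?normr1//; last by move=> n; exact: probability_setT.
rewrite (_ : bessel_with _ _ = bessel la) ?divff ?gt_eqF ?bessel_gt0//.
by congr (limn (series _)); apply/funext => n; rewrite mulr1.
Qed.

End mixture.

Section identification.
Context {R : realType}.
Variables (jp jm : R) (P0 : probability (cadlagZ R) R) (P00 : probability (jumpU R) R).
Hypotheses (jp_ge0 : 0 <= jp) (jm_ge0 : 0 <= jm).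
Hypothesis walk : random_walk_law jp jm P0.
Hypothesis P00_bridge : bridge_law P0 P00.
Let la_ge0 : 0 <= jp * jm. Proof. exact: mulr_ge0. Qed.

Lemma jump_path1 (U : jumpU R) : jump_path U 1 = 0.
Proof.
have c1 (A : {fset R}) : all (fun u => 0 < u < 1) A -> count_le A 1 = #|` A|.
  move=> /allP A01; rewrite count_leE card_fset_sum1; apply: eq_big_seq => u /A01 /andP[_ u1].
  by rewrite ltW.
have := jumpUP U; rewrite /jump_pair => /and4P[u01 d01 _ /eqP ud].
by rewrite /jump_path !c1// ud subrr.
Qed.

Lemma bridge_eventE : @bridge_event R = grid_event (0 : {ffun 'I_1 -> int}) `&` @start_at0 R.
Proof.
apply/seteqP; split => w; rewrite /bridge_event /grid_event /start_at0 /=.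
  by move=> [w0 w1]; split=> // i; rewrite ord1 ffunE divr1.
by move=> [/(_ ord0)]; rewrite ffunE divr1.
Qed.

Lemma proba_bridge_event : P0 (@bridge_event R) = P0 (grid_event (0 : {ffun 'I_1 -> int})).
Proof. by rewrite bridge_eventE (proba_start_at0I walk)//; exact: measurable_grid_event. Qed.

(** Otherwise the bridge would have total mass 0, as 0 / 0 = 0. *)
Lemma proba_bridge_neq0 : fine (P0 (@bridge_event R)) != 0.
Proof.
have := P00_bridge measurableT.
rewrite /pushforward preimage_setT probability_setT /bridge setTI.
have : P0 (@bridge_event R) \is a fin_num.
  rewrite fin_num_measure// bridge_eventE; apply: measurableI => //.
    exact: measurable_grid_event.
  exact: measurable_start_at0.
move=> fb E; apply/eqP => b0; move: E.
by rewrite -(fineK fb) b0 mul0e => /eqP; rewrite eqe oner_eq0.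
Qed.

(** When x does not end at 0 both sides vanish; otherwise this is grid_proba divided by
    the probability of the bridge event. *)
Lemma bridge_grid_jumps k (x : {ffun 'I_k -> int}) : (0 < k)%N ->
  P00 (grid_jumps x) = mixture la_ge0 (grid_jumps x).
Proof.
move=> k0.
have k1 : (k.-1 < k)%N by rewrite prednK.
have last1 : (Ordinal k1).+1%:R / k%:R = 1 :> R.
  by rewrite /= prednK// divff// pnatr_eq0 -lt0n.
have [x0|x0] := eqVneq (x (Ordinal k1)) 0; last first.
  rewrite (_ : grid_jumps x = set0) ?measure0//.
  apply/seteqP; split => // U /(_ (Ordinal k1)); rewrite last1 => h; move: x0; rewrite -h.
  by rewrite jump_path1 eqxx.
have xlast (i : 'I_k) : i.+1 = k -> x i = 0.
  by move=> ik; rewrite -x0; congr (x _); apply/val_inj => /=; have := ltn_ord i; lia.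
rewrite (@mixtureE _ _ _ _ (fun n => pos_proba n x)); last 2 first.
- by move=> n; exact: pairs_law_grid.
- by move=> n; have /andP[h0 h1] := @pos_proba_itv R k n x; rewrite ger0_norm.
have mg := @measurable_grid_event R k x.
have -> : P00 (grid_jumps x) = bridge P0 (grid_event x) by rewrite -(P00_bridge mg).
rewrite /bridge.
have -> : grid_event x `&` @bridge_event R = grid_event x `&` @start_at0 R.
  rewrite bridge_eventE; apply/seteqP; split => w; first by case=> ? [].
  move=> [xw w0]; split=> //; split=> // i; rewrite ord1 ffunE divr1 /=.
  by have := xw (Ordinal k1); rewrite last1 x0.
rewrite (proba_start_at0I walk)// proba_bridge_event.
have b0 := proba_bridge_neq0; rewrite proba_bridge_event in b0.
have fb : P0 (grid_event (0 : {ffun 'I_1 -> int})) \is a fin_num.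
  by rewrite fin_num_measure//; exact: measurable_grid_event.
have fx : P0 (grid_event x) \is a fin_num by rewrite fin_num_measure.
rewrite -(fineK fb) -(fineK fx) inver (negbTE b0) -EFinM; congr (_%:E).
have := grid_proba jp_ge0 jm_ge0 walk k0 xlast.
have Z0 : bessel (jp * jm) != 0 by rewrite gt_eqF// bessel_gt0.
by move=> E; apply: (mulIf Z0); rewrite divfK// mulrAC E mulrAC divff// mul1r.
Qed.

Lemma bridge_law_mixture A : measurable A -> P00 A = mixture la_ge0 A.
Proof.
apply: jumpU_measure_unique; first exact: probability_setT; first exact: mixture_setT.
by move=> m x; apply: bridge_grid_jumps; rewrite expn_gt0.
Qed.

End identification.

(** * Means of Lipschitz functions *)

Lemma max0_lipschitz (R : realDomainType) (a b : R) : `|Num.max a 0 - Num.max b 0| <= `|a - b|.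
Proof.
have := ler_norm (a - b); have := ler_norm (b - a); rewrite (distrC b) => h1 h2.
by rewrite ler_norml; case: (leP a 0) => ?; case: (leP b 0) => ?; apply/andP; split; lra.
Qed.

Section lipschitz.
Context {R : realType}.
Local Notation mR := (measurableTypeR R).

(** When the insertion changes the configuration, it is the application of some Psi. *)
Lemma graph_dist_insert (q : jumpU R * (mR * mR)) : (graph_dist (insert_jumps q) q.1 <= 1%:E)%E.
Proof.
have [->|ne] := eqVneq (insert_jumps q) q.1.
  apply: (@le_trans _ _ 0%E); last by rewrite lee_fin.
  by apply: ereal_inf_lbound; exists 0%N.
apply: ereal_inf_lbound; exists 1%N => //=; exists q.1; split=> //; split; first exact/eqP.
exists q.2; move: ne; rewrite /insert_jumps /Psi.
case: ifP => [h ne|_]; last by rewrite eqxx.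
split=> //.
have : insertable q.
  apply: contraNT ne => /negbTE ni; apply/eqP/val_inj => /=.
  have := insert_jumpsE q; rewrite /insert_jumps h ni; exact.
by move=> /and5P[].
Qed.

Lemma Lip1_insert (f : jumpU R -> R) : Lip1 f ->
  forall q : jumpU R * (mR * mR), `|f (insert_jumps q) - f q.1| <= 1.
Proof.
by move=> [_ fL] q; rewrite -lee_fin; apply: le_trans (fL _ _) (graph_dist_insert q).
Qed.

Variable f : jumpU R -> R.
Hypothesis mf : measurable_fun [set: jumpU R] f.
Hypothesis f1 : forall q : jumpU R * (mR * mR), `|f (insert_jumps q) - f q.1| <= 1.

Let step_law n : probability (jumpU R * (mR * mR))%type R := (@pairs_law R n \x (unif01 \x unif01))%E.

Lemma step_law_fst n (A : set (jumpU R)) : measurable A ->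
  pushforward (step_law n) fst A = @pairs_law R n A.
Proof.
move=> mA; rewrite /pushforward (_ : fst @^-1` A = A `*` setT); last first.
  by apply/seteqP; split => -[U rs] //= [].
pose V : probability (mR * mR)%type R := (unif01 \x unif01)%E.
apply: etrans (product_measure1E (@pairs_law R n) V mA measurableT) _.
by rewrite [X in (_ * X)%E](_ : _ = 1%E) ?mule1//; exact: probability_setT.
Qed.

Let mEf : measurable_fun [set: jumpU R] (EFin \o f).
Proof. exact/measurable_EFinP. Qed.

Lemma integrable_step_fst n : (@pairs_law R n).-integrable setT (EFin \o f) ->
  (step_law n).-integrable setT ((EFin \o f) \o fst).
Proof.
move=> /integrableP[_ fi]; apply/integrableP; split.
  exact: measurableT_comp.
apply: le_lt_trans fi.
rewrite [leRHS](eq_measure_integral (pushforward (step_law n) fst)); last first.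
  by move=> A mA _; apply/esym; exact: step_law_fst.
rewrite ge0_integral_pushforward//.
exact: measurableT_comp.
Qed.

Lemma integral_step_fst n : (@pairs_law R n).-integrable setT (EFin \o f) ->
  (\int[step_law n]_q (f q.1)%:E = \int[@pairs_law R n]_U (f U)%:E)%E.
Proof.
move=> fi; rewrite [RHS](eq_measure_integral (pushforward (step_law n) fst)); last first.
  by move=> A mA _; apply/esym; exact: step_law_fst.
rewrite integral_pushforward//.
exact: integrable_step_fst.
Qed.

Lemma integrable_step_insert n : (@pairs_law R n).-integrable setT (EFin \o f) ->
  (step_law n).-integrable setT ((EFin \o f) \o @insert_jumps R).
Proof.
move=> fi.
apply: (le_integrable measurableT (g := fun q => (`|f q.1| + 1)%:E)).
- exact: measurableT_comp.
- move=> q _ /=; rewrite lee_fin [leRHS]ger0_norm ?addr_ge0//.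
  rewrite -(subrK (f q.1) (f (insert_jumps q))); apply: (le_trans (ler_normD _ _)).
  by rewrite addrC lerD2l.
rewrite (_ : (fun q => _) = (fun q => `|((EFin \o f) \o fst) q| + 1%:E)%E)//.
apply: integrableD => //; first exact: integrable_abse (integrable_step_fst fi).
exact: finite_measure_integrable_cst.
Qed.

Lemma integrable_pairs_law n : (@pairs_law R n).-integrable setT (EFin \o f).
Proof.
elim: n => [|n IH].
  apply/integrableP; split => //.
  rewrite integral_dirac//; last exact: measurableT_comp.
  by rewrite diracT mul1e ltry.
apply: (@integrable_pushforward _ _ _ _ _ (@insert_jumps R) _ (step_law n)) => //.
exact: integrable_step_insert.
Qed.

Definition pairs_mean n : R := fine (\int[@pairs_law R n]_U (f U)%:E)%E.

(** Both means are integrals over the same space, of f before and after the insertion. *)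
Lemma pairs_mean_step n : `|pairs_mean n.+1 - pairs_mean n| <= 1.
Proof.
have i0 := integrable_pairs_law n; have i1 := integrable_pairs_law n.+1.
have is0 := integrable_step_fst i0; have is1 := integrable_step_insert i0.
rewrite -lee_fin -abse_EFin EFinB !fineK ?integrable_fin_num//.
have -> : (\int[@pairs_law R n.+1]_U (f U)%:E = \int[step_law n]_q (f (insert_jumps q))%:E)%E.
  exact: (@integral_pushforward _ _ _ _ _ (@insert_jumps R) _ (step_law n)).
rewrite -integral_step_fst// -integralB//.
apply: (le_trans (le_abse_integral _ _ _)) => //.
  by apply: (measurable_int (step_law n)); exact: (integrableB measurableT is1 is0).
apply: (@le_trans _ _ (\int[step_law n]_q (cst 1%:E q))%E).
  apply: ge0_le_integral => //.
  - apply: measurableT_comp => //; apply: (measurable_int (step_law n)).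
    exact: (integrableB measurableT is1 is0).
  - by move=> q _ /=; rewrite lee_fin.
by rewrite integral_cst// [X in (_ * X)%E](_ : _ = 1%E) ?mule1//; exact: probability_setT.
Qed.

Lemma pairs_mean_bound n : `|pairs_mean n| <= (`|pairs_mean 0| + 1) * n.+1%:R.
Proof.
suff h : `|pairs_mean n| <= `|pairs_mean 0| + n%:R.
  apply: (le_trans h); rewrite mulrDl mul1r lerD ?ler_nat//.
  by rewrite ler_peMr// ler1n.
elim: n => [|n IH]; first by rewrite addr0.
rewrite -(subrK (pairs_mean n) (pairs_mean n.+1)); apply: (le_trans (ler_normD _ _)).
by rewrite addrC -natr1 addrA lerD// pairs_mean_step.
Qed.

End lipschitz.

Section mixture_integral.
Context {R : realType}.
Variable la : R.
Hypothesis la_ge0 : 0 <= la.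
Local Notation mR := (measurableTypeR R).

Lemma ge0_integral_mixture (f : jumpU R -> R) (mf : measurable_fun [set: jumpU R] f)
    (f1 : forall q : jumpU R * (mR * mR), `|f (insert_jumps q) - f q.1| <= 1) :
  (forall U, 0 <= f U) ->
  (\int[mixture la_ge0]_U (f U)%:E = (bessel_with (pairs_mean f) la / bessel la)%:E)%E.
Proof.
move=> f0; have mEf : measurable_fun [set: jumpU R] (EFin \o f) by exact/measurable_EFinP.
have fE0 U : [set: jumpU R] U -> (0 <= (EFin \o f) U)%E by move=> _; rewrite lee_fin.
rewrite /mixture ge0_integral_mscale// ge0_integral_measure_series//.
rewrite mulrC EFinM; congr (_ * _)%E.
rewrite -(eseries_bessel_with la_ge0 (pairs_mean_bound mf f1)).
apply: eq_eseriesr => n _; rewrite ge0_integral_mscale//; congr (_ * _)%E.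
by rewrite /pairs_mean fineK// integrable_fin_num// integrable_pairs_law.
Qed.

(** Positive and negative parts satisfy the same increment bound as f, which reduces
    the exchange of sum and integral to nonnegative functions. *)
Lemma integral_mixture (f : jumpU R -> R) (mf : measurable_fun [set: jumpU R] f)
    (f1 : forall q : jumpU R * (mR * mR), `|f (insert_jumps q) - f q.1| <= 1) :
  (\int[mixture la_ge0]_U (f U)%:E = (bessel_with (pairs_mean f) la / bessel la)%:E)%E.
Proof.
pose fp U := Num.max (f U) 0; pose fm U := Num.max (- f U) 0.
have mfp : measurable_fun [set: jumpU R] fp.
  by apply: measurable_maxr => //; exact: measurable_cst.
have mfm : measurable_fun [set: jumpU R] fm.
  apply: measurable_maxr; last exact: measurable_cst.
  exact: measurableT_comp.
have fp1 (q : jumpU R * (mR * mR)) : `|fp (insert_jumps q) - fp q.1| <= 1.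
  exact: le_trans (max0_lipschitz _ _) (f1 q).
have fm1 (q : jumpU R * (mR * mR)) : `|fm (insert_jumps q) - fm q.1| <= 1.
  by apply: le_trans (max0_lipschitz _ _) _; rewrite opprK addrC distrC.
have fp0 U : 0 <= fp U by rewrite le_max lexx orbT.
have fm0 U : 0 <= fm U by rewrite le_max lexx orbT.
have int_pos_neg (mu : {measure set (jumpU R) -> \bar R}) :
    (\int[mu]_U (f U)%:E = \int[mu]_U (fp U)%:E - \int[mu]_U (fm U)%:E)%E.
  rewrite integralE; congr (_ - _)%E; apply: eq_integral => U _.
    by rewrite funeposE /fp EFin_max.
  by rewrite funenegE /fm EFin_max.
have pmE n : pairs_mean f n = pairs_mean fp n - pairs_mean fm n.
  rewrite /pairs_mean int_pos_neg fineB//; apply: integrable_fin_num => //.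
    exact: integrable_pairs_law.
  exact: integrable_pairs_law.
rewrite int_pos_neg !ge0_integral_mixture// -EFinB -mulrBl; congr (_ / _)%:E.
have bp := pairs_mean_bound mfp fp1; have bm := pairs_mean_bound mfm fm1.
rewrite /bessel_with -limB; [|exact: cvg_series_bessel_with bp|exact: cvg_series_bessel_with bm].
congr (limn _); apply/funext => N; rewrite /series /= fctE /= -sumrB; apply: eq_bigr => n _.
by rewrite pmE mulrBr.
Qed.

End mixture_integral.

Theorem proposition3p17 (R : realType) (jp jm hp hm : R)
  (jp_ge0 : 0 <= jp) (jm_ge0 : 0 <= jm) (hp_ge0 : 0 <= hp) (hm_ge0 : 0 <= hm)
  (P0 Q0 : probability (cadlagZ R) R)
  (P0_walk : random_walk_law jp jm P0) (Q0_walk : random_walk_law hp hm Q0)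
  (P00 Q00 : probability (jumpU R) R)
  (P00_bridge : bridge_law P0 P00) (Q00_bridge : bridge_law Q0 Q00) :
  (dW1 P00 Q00 <= (9 * `|jp * jm - hp * hm|)%:E)%E.
Proof.
apply: ge_ereal_sup => _ [f [fLip _ _] <-].
have [mf _] := fLip; have f1 := Lip1_insert fLip.
have intP : (\int[P00]_U (f U)%:E = \int[mixture (mulr_ge0 jp_ge0 jm_ge0)]_U (f U)%:E)%E.
  by apply: eq_measure_integral => A mA _; exact: (bridge_law_mixture _ _ P0_walk).
have intQ : (\int[Q00]_U (f U)%:E = \int[mixture (mulr_ge0 hp_ge0 hm_ge0)]_U (f U)%:E)%E.
  by apply: eq_measure_integral => A mA _; exact: (bridge_law_mixture _ _ Q0_walk).
rewrite intP intQ !integral_mixture// -EFinB abse_EFin lee_fin.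
apply: le_trans (bessel_mean_lip _ _ (pairs_mean_bound mf f1) (pairs_mean_step mf f1)) _.
- exact: mulr_ge0.
- exact: mulr_ge0.
- by rewrite ler_peMl// ler1n.
Qed.
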